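(* Let $\Bbbk=\mathbb{Q}$ or $\Bbbk=\mathbb{Z}/p\mathbb{Z}$ ($p$ a prime) and $S=\Bbbk[x_1,\ldots,x_n]$. If $I\subset S$ is an ideal (not necessarily homogeneous) such that $\mathrm{in}_{\prec} I$ is a square-free complete intersection for some term order $\prec$ on $S$, then $I$ is Hirsch, i.e. $\operatorname{diam}(I)\le\operatorname{height}(I)$.
   Context: $\mathrm{in}_\prec I$ is the initial ideal of $I$, generated by the initial monomials of the nonzero elements of $I$; it is square-free if it is generated by square-free monomials. For a proper ideal $J\subset S$ with minimal primes $\mathfrak{q}_1,\ldots,\mathfrak{q}_t$, the dual graph $G(J)$ is the simple graph with vertex set $\{1,\ldots,t\}$ in which $\{i,j\}$ (with $i\ne j$) is an edge if and only if $\operatorname{height}(\mathfrak{q}_i+\mathfrak{q}_j)=\operatorname{height}(J)+1$ (the unit ideal is regarded as having height $\infty$). The diameter $\operatorname{diam}(J)$ is the diameter of the graph $G(J)$: the maximum over pairs of vertices of their distance, where the distance of two vertices is the minimum number of edges in a path connecting them ($0$ if they are equal, $\infty$ if no path connects them). The ideal $J$ is called Hirsch if $\operatorname{diam}(J)\le\operatorname{height}(J)$. *)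

(* Defs.v *)
From HB Require Import structures.
From mathcomp Require Import all_boot all_order all_algebra.
From mathcomp Require Import boolp classical_sets.
From mathcomp Require Import mpoly.

Set Implicit Arguments.
Unset Strict Implicit.
Unset Printing Implicit Defensive.

Import Order.TTheory GRing.Theory.

Local Open Scope classical_set_scope.
Local Open Scope ring_scope.

(* Extended natural numbers: [None] stands for infinity. *)
Definition enat := option nat.

Definition enat_le (a b : enat) : bool :=
  match a, b with
  | _, None => true
  | None, Some _ => false
  | Some k, Some l => (k <= l)%N
  end.

Definition enat_succ (a : enat) : enat := omap succn a.

(* The infimum of the empty set, and of {infinity}, is infinity. *)
Definition enat_inf (A : set enat) : enat :=
  if `[< exists k, A (Some k) >]
  then Some (infimum 0%N [set k | A (Some k)]) else None.

Definition enat_sup (A : set enat) : enat :=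
  enat_inf [set b | forall a, A a -> enat_le a b].

Section Ideals.
Variable R : comNzRingType.
Implicit Types (I J P Q : set R) (G : set R) (fs : seq R).

(* Unlike [idealr_closed], the unit ideal is allowed. *)
Record is_ideal I : Prop := IsIdeal {
  is_ideal0 : I 0;
  is_idealD : forall x y, I x -> I y -> I (x + y);
  is_idealM : forall a x, I x -> I (a * x)
}.

Definition ideal_gen G : set R :=
  [set x | forall J, is_ideal J -> G `<=` J -> J x].

Definition ideal_sum I J : set R := [set x + y | x in I & y in J].

Definition is_prime_ideal P : Prop :=
  idealr_closed (mem P) /\ prime_idealr_closed (mem P).

Definition is_minimal_prime J P : Prop :=
  [/\ is_prime_ideal P, J `<=` P &
      forall Q, is_prime_ideal Q -> J `<=` Q -> Q `<=` P -> Q = P].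

Definition is_prime_chain P (k : nat) (c : nat -> set R) : Prop :=
  [/\ c k = P,
      forall i, (i <= k)%N -> is_prime_ideal (c i) &
      forall i, (i < k)%N -> c i `<` c i.+1].

Definition prime_height P : enat :=
  enat_sup [set Some k | k in [set k | exists c, is_prime_chain P k c]].

(* No prime contains the unit ideal, whose height is therefore infinite. *)
Definition height J : enat :=
  enat_inf [set prime_height P | P in [set P | is_prime_ideal P /\ J `<=` P]].

(* The vertices of G(J) are the minimal primes of J themselves. When R is
   Noetherian and J is proper, height J is finite, so that the last equation
   is never infinity = infinity + 1. *)
Definition dual_edge J : rel (set R) := fun P Q =>
  `[< [/\ is_minimal_prime J P, is_minimal_prime J Q, P <> Q &
          height (ideal_sum P Q) = enat_succ (height J)] >].

Definition dual_dist J P Q : enat :=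
  enat_inf [set Some (size w) | w in
              [set w : seq (set R) | path (dual_edge J) P w /\ last P w = Q]].

Definition diam J : enat :=
  enat_sup [set dual_dist J P Q | P in is_minimal_prime J
                                & Q in is_minimal_prime J].

Definition Hirsch J : Prop := enat_le (diam J) (height J).

Definition is_regular_seq fs : Prop :=
  ~ ideal_gen [set` fs] 1 /\
  forall i x, (i < size fs)%N ->
    ideal_gen [set` take i fs] (fs`_i * x) -> ideal_gen [set` take i fs] x.

Definition is_complete_intersection J : Prop :=
  exists2 fs, is_regular_seq fs & J = ideal_gen [set` fs].

End Ideals.

Section InitialIdeals.
Variables (n : nat) (K : fieldType).
Implicit Types (le : rel 'X_{1..n}) (m : 'X_{1..n}).
Implicit Types (f : {mpoly K[n]}) (I J : set {mpoly K[n]}).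

Record is_term_order le : Prop := IsTermOrder {
  term_order_total : total le;
  term_order_anti : antisymmetric le;
  term_order_trans : transitive le;
  term_order_min : forall m, le 0%MM m;
  term_order_add : forall m m1 m2, le m1 m2 -> le (m1 + m)%MM (m2 + m)%MM
}.

(* The zero polynomial has no initial monomial. The library's [mlead] is tied
   to one particular term order. *)
Definition is_initial_monomial le f m : Prop :=
  m \in msupp f /\ {in msupp f, forall m', le m' m}.

Definition initial_ideal le I : set {mpoly K[n]} :=
  ideal_gen [set 'X_[m] | m in
               [set m | exists2 f, I f & is_initial_monomial le f m]].

Definition is_squarefree_monomial_ideal J : Prop :=
  exists2 G : set 'X_{1..n},
    forall m, G m -> forall i, (m i <= 1)%N &
    J = ideal_gen [set 'X_[m] | m in G].

End InitialIdeals.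

Inductive is_Q_or_Fp : fieldType -> Prop :=
  | Is_Q : is_Q_or_Fp rat
  | Is_Fp (p : nat) : prime p -> is_Q_or_Fp 'F_p.

(* Main.v *)
Require Import Defs.
From mathcomp Require Import all_boot all_order all_algebra all_fingroup.
From mathcomp Require Import boolp classical_sets.
From mathcomp Require Import mpoly ring zify.

(** Combinatorics of the initial ideal. A square-free monomial complete
    intersection has minimal generators with pairwise disjoint supports
    [A j], [j < h] ([complete_intersection_disjoint]). Its minimal primes are
    generated by the variables of a transversal, that is, of a choice of one
    variable in each [A j]. Two transversals are joined by a walk of [h] steps,
    each of which changes a single entry. The proof transports this walk to [I]:
    say that [P] lies over a set [V] of variables if every initial monomial of
    [P] involves a variable of [V]. Each minimal prime of [I] lies over some
    transversal and each transversal has exactly one minimal prime of [I] over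
    it ([transversal_below], [minimal_prime_over], [minimal_prime_unique]), and
    the primes over two transversals that differ in one entry are equal or
    adjacent ([adjacent_edge]).

    Heights. If [P] lies over [V], its height is at most [#|V|]
    ([chain_length], a count of monomials). Conversely, polynomials of [I] whose
    initial monomials are the [h] coprime generators form a regular sequence, so
    that every prime containing [I] has height at least [h] ([coprime_regular],
    [regular_seq_chain]). In particular the height of [I] is at least [h], and
    two minimal primes are adjacent as soon as a prime of height at most
    [h + 1] contains both.

    Initial ideals of sums. Let the initial ideal of [I] be radical, let [A] and
    [B] contain [I] and have their product inside [I]. If [f = a + b] with [a]
    in [A] and [b] in [B], then [a ^+ 2] and [f * a] agree modulo [I], and this
    forces the initial ideal of [A + B] to be the sum of those of [A] and [B]
    ([initial_sum]). It is applied to a minimal prime [P] and to the colon ideal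
    of [I] by [P], the intersection of the other minimal primes: if [P] and
    another minimal prime lie over [V], some prime over [V] contains both ideals
    ([meeting_prime]). For a transversal this contradicts the height bounds,
    which gives uniqueness. For the union [V] of two transversals that differ
    in one entry, it gives a prime of height at most [h + 1] containing [P] and
    another minimal prime, and what remains is to identify the latter.

    A minimal prime over such a union lies over one of the two transversals
    ([lies_over_adjacent]). Otherwise the colon ideal of [I] by this prime would
    have the same initial ideal as [I], up to monomials free of [V]. A form of
    Nakayama's lemma for initial monomials ([initial_nakayama]) would then make
    it equal to [I] up to a denominator whose initial monomial is free of [V],
    which is impossible because the colon ideal is not contained in the prime. *)

Set Implicit Arguments.
Unset Strict Implicit.
Unset Printing Implicit Defensive.

Import Order.TTheory GRing.Theory.

(** * Extended natural numbers *)

Section EnatTheory.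
Implicit Types (A : set enat) (a b : enat).

Lemma infimum_nat (A : set nat) k : A k -> A (infimum 0%N A) /\ (infimum 0%N A <= k)%N.
Proof.
move=> Ak; have exA : exists k, `[< A k >] by exists k; apply/asboolP.
case: (ex_minnP exA) => m /asboolP Am m_min.
have inf_m : infimums A m.
  split => [x Ax|x lbx]; last exact: lbx.
  by rewrite leEnat; apply: m_min; apply/asboolP.
suff -> : infimum 0%N A = m by split=> //; apply: m_min; apply/asboolP.
rewrite /infimum; case: eqP => [A0|_]; first by rewrite A0 in Am.
exact/(@is_subset1_infimums _ _ A)/inf_m/(xgetPex _ (ex_intro _ m inf_m)).
Qed.

Lemma enat_le_trans b a c : enat_le a b -> enat_le b c -> enat_le a c.
Proof. by case: a b c => [a|] [b|] [c|] //=; apply: leq_trans. Qed.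

Lemma enat_le_anti a b : enat_le a b -> enat_le b a -> a = b.
Proof.
by case: a b => [a|] [b|] //= ab ba; congr Some; apply/eqP; rewrite eqn_leq ab.
Qed.

Lemma enat_le_succ a b : enat_le a b -> enat_le (enat_succ a) (enat_succ b).
Proof. by case: a b => [a|] [b|]. Qed.

Lemma enat_inf_le A a : A a -> enat_le (enat_inf A) a.
Proof.
case: a => [k|] Aa; rewrite /enat_inf; case: asboolP => //.
- by move=> _; case: (@infimum_nat [set k | A (Some k)] k Aa).
- by move=> noA; case: noA; exists k.
Qed.

Lemma enat_le_inf A b : (forall a, A a -> enat_le b a) -> enat_le b (enat_inf A).
Proof.
move=> lbA; rewrite /enat_inf; case: asboolP => [[k Ak]|_]; last by case: b lbA.
by apply: lbA; case: (@infimum_nat [set k | A (Some k)] k Ak).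
Qed.

Lemma enat_le_sup A a : A a -> enat_le a (enat_sup A).
Proof. by move=> Aa; apply: enat_le_inf => b; apply. Qed.

Lemma enat_sup_le A b : (forall a, A a -> enat_le a b) -> enat_le (enat_sup A) b.
Proof. by move=> ubA; apply: enat_inf_le. Qed.

End EnatTheory.

(** * Ideals, primes and heights in commutative rings *)

Section CommutativeAlgebra.
Variable R : comNzRingType.
Implicit Types (I J P Q M : set R) (x y : R).
Local Open Scope ring_scope.
Local Open Scope classical_set_scope.

Lemma is_idealMr I x y : is_ideal I -> I x -> I (x * y).
Proof. by move=> [_ _ IM] Ix; rewrite mulrC; apply: IM. Qed.

Lemma is_idealN I x : is_ideal I -> I x -> I (- x).
Proof. by move=> [_ _ IM] Ix; rewrite -mulN1r; apply: IM. Qed.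

Lemma is_idealB I x y : is_ideal I -> I x -> I y -> I (x - y).
Proof. by move=> II Ix Iy; apply: is_idealD => //; apply: is_idealN. Qed.

Lemma is_ideal_sum I (T : Type) (r : seq T) (p : pred T) (F : T -> R) :
  is_ideal I -> (forall i, p i -> I (F i)) -> I (\sum_(i <- r | p i) F i).
Proof.
by move=> II IF; apply: (big_ind (fun x => I x)) => //; case: II.
Qed.

Lemma ideal_genP (G : set R) : is_ideal (ideal_gen G).
Proof.
split=> [J [J0 _ _] _ //|x y Gx Gy J JJ GJ|a x Gx J JJ GJ].
- by apply: is_idealD => //; [apply: Gx | apply: Gy].
- by apply: is_idealM => //; apply: Gx.
Qed.

Lemma sub_ideal_gen (G : set R) : G `<=` ideal_gen G.
Proof. by move=> x Gx J _; apply. Qed.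

Lemma ideal_gen_rcons (s : seq R) f x :
  ideal_gen [set` rcons s f] x ->
  exists a, exists2 y, ideal_gen [set` s] y & x = a * f + y.
Proof.
have GI := ideal_genP [set` s].
move=> /(_ [set x | exists a, exists2 y, ideal_gen [set` s] y & x = a * f + y]).
apply; first split.
- by exists 0, 0; [exact: is_ideal0 GI|rewrite mul0r addr0].
- move=> _ _ [a [y Gy ->]] [a' [y' Gy' ->]]; exists (a + a'), (y + y').
    exact: (is_idealD GI).
  by rewrite mulrDl addrACA.
- move=> b _ [a [y Gy ->]]; exists (b * a), (b * y); first exact: (is_idealM GI).
  by rewrite mulrDr mulrA.
- move=> g; rewrite /= mem_rcons inE => /predU1P[->|gs].
    by exists 1, 0; [exact: is_ideal0 GI|rewrite mul1r addr0].
  by exists 0, g; [apply: sub_ideal_gen|rewrite mul0r add0r].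
Qed.

Lemma ideal_gen_seqP (s : seq R) x : ideal_gen [set` s] x ->
  exists a : 'I_(size s) -> R, x = \sum_i a i * s`_i.
Proof.
move=> /(_ [set x | exists a : 'I_(size s) -> R, x = \sum_i a i * s`_i]).
apply; first split.
- by exists (fun=> 0); rewrite big1 // => i _; rewrite mul0r.
- move=> _ _ [a ->] [b ->]; exists (fun i => a i + b i).
  by rewrite -big_split; apply: eq_bigr => i _; rewrite mulrDl.
- move=> b _ [a ->]; exists (fun i => b * a i).
  by rewrite mulr_sumr; apply: eq_bigr => i _; rewrite mulrA.
- move=> f fs; have ltf : (index f s < size s)%N by rewrite index_mem.
  exists (fun i => (i == Ordinal ltf)%:R); rewrite (bigD1 (Ordinal ltf)) //=.
  by rewrite eqxx mul1r nth_index // big1 ?addr0 // => i /negPf->; rewrite mul0r.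
Qed.

Lemma ideal_sumP I J : is_ideal I -> is_ideal J -> is_ideal (ideal_sum I J).
Proof.
move=> [I0 ID IM] [J0 JD JM]; split.
- by exists 0 => //; exists 0 => //; rewrite addr0.
- move=> _ _ [x Ix [y Jy <-]] [x' Ix' [y' Jy' <-]].
  by exists (x + x'); [apply: ID|exists (y + y'); [apply: JD|rewrite addrACA]].
- move=> a _ [x Ix [y Jy <-]].
  by exists (a * x); [apply: IM|exists (a * y); [apply: JM|rewrite mulrDr]].
Qed.

Lemma ideal_suml I J : is_ideal J -> I `<=` ideal_sum I J.
Proof. by move=> [J0 _ _] x Ix; exists x => //; exists 0 => //; rewrite addr0. Qed.

Lemma ideal_sumr I J : is_ideal I -> J `<=` ideal_sum I J.
Proof. by move=> [I0 _ _] x Jx; exists 0 => //; exists x => //; rewrite add0r. Qed.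

Lemma ideal_sum_min I J P :
  is_ideal P -> I `<=` P -> J `<=` P -> ideal_sum I J `<=` P.
Proof.
by move=> PP IP JP _ [x Ix [y Jy <-]]; apply: is_idealD; [|apply: IP|apply: JP].
Qed.

Definition colon I P : set R := [set x | forall y, P y -> I (x * y)].

Lemma colonP I P : is_ideal I -> is_ideal (colon I P).
Proof.
move=> [I0 ID IM]; split.
- by move=> y _; rewrite mul0r.
- by move=> x x' Ix Ix' y Py; rewrite mulrDl; apply: ID; [apply: Ix|apply: Ix'].
- by move=> a x Ix y Py; rewrite -mulrA; apply: IM; apply: Ix.
Qed.

Lemma sub_colon I P : is_ideal I -> I `<=` colon I P.
Proof. by move=> II x Ix y _; apply: is_idealMr. Qed.

Lemma prime_is_ideal P : is_prime_ideal P -> is_ideal P.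
Proof.
move=> [[P0 _ PM] _]; have mP x : P x -> x \in mem P by move=> Px; apply/mem_set.
have Pm x : x \in mem P -> P x by move/set_mem.
split; first exact: Pm.
- by move=> x y /mP Px /mP Py; apply: Pm; rewrite -[x]mul1r; apply: PM.
- by move=> a x /mP Px; apply: Pm; rewrite -[a * x]addr0; apply: PM.
Qed.

Lemma prime_proper P : is_prime_ideal P -> ~ P 1.
Proof. by move=> [[_ nP1 _] _] P1; case/negP: nP1; apply/mem_set. Qed.

Lemma prime_mul P x y : is_prime_ideal P -> P (x * y) -> P x \/ P y.
Proof.
move=> [_ PM] Pxy; have /orP := PM x y (mem_set Pxy).
by case=> /set_mem; [left|right].
Qed.

Lemma primeI P : is_ideal P -> ~ P 1 ->
  (forall x y, P (x * y) -> P x \/ P y) -> is_prime_ideal P.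
Proof.
move=> [P0 PD PM] P1 Pm; split; first split.
- exact/mem_set.
- by apply/negP => /set_mem.
- move=> a x y /set_mem Px /set_mem Py; apply/mem_set.
  by apply: PD => //; apply: PM.
- move=> x y /set_mem /Pm[]?; apply/orP; by [left; apply/mem_set|right; apply/mem_set].
Qed.

(** Zorn's lemma provides an ideal maximal among those containing [J] and
    avoiding [M]; it is prime, because if neither factor of a product lies in
    it, adjoining either factor makes it meet [M]. *)
Lemma prime_avoiding J M : is_ideal J -> M 1 ->
    (forall x y, M x -> M y -> M (x * y)) -> (forall x, J x -> ~ M x) ->
  exists P, [/\ is_prime_ideal P, J `<=` P & forall x, P x -> ~ M x].
Proof.
move=> JJ M1 MM JM.
pose good A := is_ideal (A `|` J) /\ forall x, A x -> ~ M x.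
have [F FG Ftot|A [[AJ AM] Amax]] := @Zorn_bigcup R good.
  split; last by move=> x [X FX Xx]; case: (FG _ FX) => _; apply.
  split.
  - by right; case: JJ.
  - have add X x y : F X -> X x \/ J x -> X y \/ J y ->
        ((\bigcup_(X in F) X) `|` J) (x + y).
      move=> FX Xx Xy; case: (FG _ FX) => XJ _.
      by case: (is_idealD XJ Xx Xy); [left; exists X|right].
    move=> x y [[X FX Xx]|Jx] [[Y FY Yy]|Jy].
    + by case: (Ftot _ _ FX FY) => XY; [apply: (add Y)|apply: (add X)] => //;
        left => //; apply: XY.
    + by apply: (add X) => //; [left|right].
    + by apply: (add Y) => //; [right|left].
    + by right; apply: is_idealD.
  - move=> a x [[X FX Xx]|Jx]; last by right; apply: is_idealM.
    case: (FG _ FX) => XJ _; case: (is_idealM XJ a (or_introl Xx)); last by right.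
    by left; exists X.
have AJM x : (A `|` J) x -> ~ M x by move=> [/AM|/JM].
exists (A `|` J); split=> //; first apply: primeI => //.
- by move=> /AJM.
- move=> x y Axy; apply: contrapT => /not_orP[nAx nAy].
  have meets z : ~ (A `|` J) z -> exists2 b, (A `|` J) b & exists a, M (b + a * z).
    move=> nAz; apply: contrapT => noM.
    pose B := [set w | exists2 b, (A `|` J) b & exists a, w = b + a * z].
    have AB : A `|` J `<=` B.
      by move=> w Aw; exists w => //; exists 0; rewrite mul0r addr0.
    apply: (Amax B); first split.
    + by move=> w Aw; apply: AB; left.
    + by move=> BA; apply: nAz; left; apply: BA; exists 0;
        [apply: is_ideal0|exists 1; rewrite mul1r add0r].
    + suff BB : is_ideal B.
        split; last first.
          by move=> w [b Ab [a ->]] Mw; apply: noM; exists b => //; exists a.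
        have -> // : B `|` J = B.
        by apply/seteqP; split=> [w [//|Jw]|w Bw]; [apply: AB; right|left].
      split; first by exists 0; [apply: is_ideal0|exists 0; rewrite mul0r addr0].
      * move=> _ _ [b Ab [a ->]] [b' Ab' [a' ->]].
        by exists (b + b'); [apply: is_idealD|exists (a + a'); ring].
      * move=> c _ [b Ab [a ->]].
        by exists (c * b); [apply: is_idealM|exists (c * a); ring].
  have [b Ab [a Mx]] := meets _ nAx; have [b' Ab' [a' My]] := meets _ nAy.
  apply: AJM (MM _ _ Mx My).
  have -> : (b + a * x) * (b' + a' * y) =
    (b' + a' * y) * b + ((a * x) * b' + (a * a') * (x * y)) by ring.
  apply: (is_idealD AJ); first exact: is_idealM.
  by apply: (is_idealD AJ); apply: is_idealM.
Qed.

(** Zorn's lemma is applied to unions of chains of complements: [V A] is the prime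
    encoded by its complement [A] in [P]. *)
Lemma minimal_prime_below J P : is_prime_ideal P -> J `<=` P ->
  exists2 P0, is_minimal_prime J P0 & P0 `<=` P.
Proof.
move=> PP JP; pose V A := [set x | P x /\ ~ A x].
have [|A [[AP JA] Amax]] := @Zorn_bigcup R [set A | is_prime_ideal (V A) /\ J `<=` V A].
  move=> F FG Ftot; have VF x : V (\bigcup_(X in F) X) x <->
      P x /\ forall X, F X -> V X x.
    split=> [[Px nFx]|[Px VFx]].
      by split=> // X FX; split=> // Xx; apply: nFx; exists X.
    by split=> // -[X FX Xx]; case: (VFx _ FX).
  have idP := prime_is_ideal PP.
  have idV X : F X -> is_ideal (V X) by move=> /FG[/prime_is_ideal].
  split; last by move=> x Jx; apply/VF; split=> [|X /FG[_]]; [exact: JP|apply].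
  apply: primeI; first split.
  - by apply/VF; split=> [|X FX]; apply: is_ideal0 => //; apply: idV.
  - move=> x y /VF[Px Vx] /VF[Py Vy]; apply/VF; split=> [|X FX].
      exact: is_idealD.
    by apply: (is_idealD (idV _ FX)); [apply: Vx|apply: Vy].
  - move=> a x /VF[Px Vx]; apply/VF; split=> [|X FX]; first exact: is_idealM.
    by apply: (is_idealM (idV _ FX)); apply: Vx.
  - by move=> /VF[/(prime_proper PP)].
  - move=> x y /VF[Pxy Vxy]; apply: contrapT => /not_orP[nx ny].
    have out z : ~ V (\bigcup_(X in F) X) z -> ~ P z \/ exists2 X, F X & ~ V X z.
      move=> nz; apply: contrapT => noX; apply: nz; apply/VF; split.
        by apply: contrapT => nPz; apply: noX; left.
      by move=> X FX; apply: contrapT => nX; apply: noX; right; exists X.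
    have big X z : F X -> ~ V X z -> ~ P x \/ ~ V X x -> ~ P y \/ ~ V X y -> False.
      move=> FX _ nVx nVy; have /FG[VP _] := FX.
      by case: (prime_mul VP (Vxy _ FX)) => -[? ?]; [case: nVx|case: nVy]; case.
    have mono X Y z : X `<=` Y -> ~ V X z -> ~ V Y z.
      by move=> XY nV [Pz nY]; apply: nV; split=> // /XY.
    case: (out _ nx) (out _ ny) => [nPx|[X FX nVx]] [nPy|[Y FY nVy]].
    + by case: (prime_mul PP Pxy).
    + by apply: (big Y y) => //; [left|right].
    + by apply: (big X x) => //; [right|left].
    + case: (Ftot _ _ FX FY) => XY.
        by apply: (big Y y) => //; right => //; apply: mono XY _.
      by apply: (big X x) => //; right => //; apply: mono XY _.
exists (V A); last by move=> x [].
split=> // Q QP JQ QV; apply: contrapT => neQ.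
have VAQ : V (A `|` ~` Q) = Q.
  apply/seteqP; split=> [x [_ nA]|x Qx].
    by apply: contrapT => nQ; apply: nA; right.
  by case: (QV _ Qx) => Px nA; split=> // -[].
apply: (Amax (A `|` ~` Q)); last by rewrite /= VAQ.
split; first by move=> x; left.
move=> BA; apply: neQ; apply/seteqP; split=> // x [Px nA].
by apply: contrapT => nQ; apply: nA; apply: BA; right.
Qed.

(** If [x] lies in all the primes between [I] and [P], it is nilpotent in the
    localization of the quotient by [I] at [P]: otherwise some prime avoids the
    products of a power of [x] with an element outside [P]. *)
Lemma locally_nilpotent I P x : is_ideal I -> is_prime_ideal P ->
    (forall Q, is_prime_ideal Q -> I `<=` Q -> Q `<=` P -> Q x) ->
  exists2 d, ~ P d & exists k, I (d * x ^+ k).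
Proof.
move=> II PP Px; apply: contrapT => noI.
have [||||Q [QP IQ QM]] :=
    @prime_avoiding I [set w | exists2 d, ~ P d & exists k, w = d * x ^+ k].
- by [].
- by exists 1; [apply: prime_proper|exists 0%N; rewrite expr0 mulr1].
- move=> _ _ [d nd [k ->]] [d' nd' [k' ->]].
  exists (d * d'); first by move=> /(prime_mul PP)[].
  by exists (k + k')%N; rewrite exprD mulrACA.
- by move=> w Iw [d nd [k wE]]; apply: noI; exists d => //; exists k; rewrite -wE.
apply: (QM x).
  apply: Px => // y Qy; apply: contrapT => nPy; apply: (QM y) => //.
  by exists y => //; exists 0%N; rewrite expr0 mulr1.
by exists 1; [apply: prime_proper|exists 1%N; rewrite mul1r].
Qed.

Definition is_radical I := forall x, I (x ^+ 2) -> I x.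

Lemma is_radical_exp I x k : is_ideal I -> is_radical I -> I (x ^+ k.+1) -> I x.
Proof.
move=> II Irad Ixk; have : I (x ^+ (2 ^ k)%N).
  by rewrite -(subnK (ltn_expl k (ltnSn 1))) exprD; apply: is_idealM.
elim: k {Ixk} => [|k IHk] //; rewrite expnS mulnC exprM => /Irad; exact: IHk.
Qed.

Definition is_fin_gen P := exists s : seq R, P = ideal_gen [set` s].

(** Modulo the radical ideal [I], the elements of [J] are nilpotent in the
    localization at [P], hence zero there; by finite generation one denominator
    suffices. *)
Lemma locally_zero I P J : is_ideal I -> is_radical I -> is_prime_ideal P ->
    is_fin_gen J ->
    (forall Q, is_prime_ideal Q -> I `<=` Q -> Q `<=` P -> J `<=` Q) ->
  I `<=` P -> exists2 d, ~ P d & colon I J d.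
Proof.
move=> II Irad PP [s ->] JQ IP.
have one x : x \in s -> exists2 d, ~ P d & I (d * x).
  move=> xs; have [|d nd [k Idx]] := @locally_nilpotent I P x II PP.
    by move=> Q QP IQ QP'; apply: (JQ Q) => //; apply: sub_ideal_gen.
  exists d => //; apply: (@is_radical_exp I _ k) => //.
  rewrite exprMn exprSr [x ^+ _]exprS.
  have -> : d ^+ k * d * (x * x ^+ k) = d ^+ k * x * (d * x ^+ k) by ring.
  exact: is_idealM.
suff [d nd Ids] : exists2 d, ~ P d & forall x, x \in s -> I (d * x).
  exists d => // x sx; apply: (sx [set x | I (d * x)]) => //; split.
  - by rewrite /= mulr0; apply: is_ideal0.
  - by move=> u v Iu Iv; rewrite /= mulrDr; apply: is_idealD.
  - by move=> a u Iu; rewrite /= mulrCA; apply: is_idealM.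
elim: s one {JQ} => [|x s IHs] one; first by exists 1; first exact: prime_proper.
have [d nd Id] := one x (mem_head _ _).
have [y ys|d' nd' Id'] := IHs; first by apply: one; rewrite inE ys orbT.
exists (d * d'); first by move=> /(prime_mul PP)[].
move=> y; rewrite inE => /predU1P[->|ys].
- by rewrite mulrAC; apply: is_idealMr.
- by rewrite -mulrA; apply: is_idealM => //; apply: Id'.
Qed.

Definition has_chain P k := exists c, is_prime_chain P k c.

Lemma has_chain0 P : is_prime_ideal P -> has_chain P 0.
Proof. by move=> PP; exists (fun=> P); split. Qed.

Lemma has_chainS P Q k : has_chain P k -> is_prime_ideal Q -> P `<` Q ->
  has_chain Q k.+1.
Proof.
move=> [c [cP cprime cS]] QP PQ; exists (fun i => if (i <= k)%N then c i else Q).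
split=> [|i _|i].
- by rewrite ltnn.
- by case: ifP => // /cprime.
- rewrite ltnS => le_ik; have /predU1P[->|ik] : (i == k) || (i < k)%N.
    by rewrite -leq_eqVlt.
  + by rewrite leqnn ltnn cP.
  + by rewrite le_ik ik; apply: cS.
Qed.

Lemma has_chain_le P k : has_chain P k -> enat_le (Some k) (prime_height P).
Proof. by move=> Pk; apply: enat_le_sup; exists k. Qed.

Lemma prime_height_le P a :
  (forall k, has_chain P k -> enat_le (Some k) a) -> enat_le (prime_height P) a.
Proof. by move=> Pa; apply: enat_sup_le => _ [k Pk <-]; apply: Pa. Qed.

Lemma prime_height_lt P Q : is_prime_ideal P -> is_prime_ideal Q -> P `<` Q ->
  enat_le (enat_succ (prime_height P)) (prime_height Q).
Proof.
move=> PP QP PQ; case EQ: (prime_height Q) => [k|]; last by case: prime_height.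
have chainQ l : has_chain P l -> (l < k)%N.
  by move=> /has_chainS/(_ QP PQ)/has_chain_le; rewrite EQ.
have k0 := chainQ _ (has_chain0 PP).
rewrite -(prednK k0); apply: (@enat_le_succ _ (Some k.-1)).
by apply: prime_height_le => l /chainQ lk; rewrite /= -ltnS prednK.
Qed.

Lemma height_le J P : is_prime_ideal P -> J `<=` P ->
  enat_le (height J) (prime_height P).
Proof. by move=> PP JP; apply: enat_inf_le; exists P. Qed.

Lemma le_height J a :
  (forall P, is_prime_ideal P -> J `<=` P -> enat_le a (prime_height P)) ->
  enat_le a (height J).
Proof. by move=> Ja; apply: enat_le_inf => _ [P [PP JP] <-]; apply: Ja. Qed.

(** An element of a minimal prime of [J] is a zero divisor modulo [J]; hence each
    term of a regular sequence is outside the minimal primes of the previous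
    ones, which makes room for one more prime in the chain. *)
Lemma regular_seq_chain (fs : seq R) P : is_regular_seq fs -> is_prime_ideal P ->
  (forall f, f \in fs -> P f) -> has_chain P (size fs).
Proof.
move=> [_ reg] PP fsP.
suff chain i : (i <= size fs)%N -> forall P, is_prime_ideal P ->
    (forall f, f \in take i fs -> P f) -> has_chain P i.
  by apply: chain => //; rewrite take_size.
elim: i {P PP fsP} => [_ P PP _|i IHi ltis P PP fsP].
  exact: has_chain0.
have [|P0 [P0P JP0 P0min] P0sub] := @minimal_prime_below (ideal_gen [set` take i fs]) P PP.
  move=> x /(_ P); apply; first exact: prime_is_ideal.
  by move=> f fi; apply: fsP; rewrite (take_nth 0) // mem_rcons inE fi orbT.
have P0i : has_chain P0 i.
  by apply: IHi; [exact: ltnW|by []|move=> f fi; apply: JP0; apply: sub_ideal_gen].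
apply: has_chainS P0i PP _; split=> // PP0.
have Pfi : P0 fs`_i by apply/PP0/fsP; rewrite (take_nth 0) // mem_rcons mem_head.
have [|d nd [k Jdk]] := @locally_nilpotent (ideal_gen [set` take i fs]) P0 fs`_i
   (ideal_genP _) P0P.
  by move=> Q QP JQ QP0; rewrite (P0min Q).
apply: nd; apply: JP0; elim: k Jdk => [|k IHk]; first by rewrite expr0 mulr1.
by rewrite exprS mulrCA => /(reg _ _ ltis).
Qed.

End CommutativeAlgebra.

(** * Term orders and initial monomials *)

(** Dickson's lemma, by induction on the number [k] of coordinates compared: for
    a new coordinate [v], the monomials whose exponent at [v] is below the
    largest one of the finite set found so far fall into finitely many slices. *)
Lemma dickson n (S : set 'X_{1..n}) :
  exists2 s : seq 'X_{1..n}, (forall m, m \in s -> S m) &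
    forall m, S m -> exists2 m0, m0 \in s & (m0 <= m)%MM.
Proof.
pose lek k (m1 m2 : 'X_{1..n}) := forall i : 'I_n, (i < k)%N -> (m1 i <= m2 i)%N.
suff dick k : forall S : set 'X_{1..n},
    exists2 s : seq 'X_{1..n}, (forall m, m \in s -> S m) &
    forall m, S m -> exists2 m0, m0 \in s & lek k m0 m.
  have [s sS Ss] := dick n S; exists s => // m /Ss[m0 m0s le0].
  by exists m0 => //; apply/mnm_lepP => i; apply: le0.
elim: k {S} => [|k IHk] S.
  have [[m Sm]|noS] := pselect (exists m, S m).
    by exists [:: m] => [m'|m' _]; [rewrite inE => /eqP->|exists m; rewrite ?mem_head].
  by exists [::] => // m Sm; case: noS; exists m.
have [kn|nk] := ltnP k n; last first.
  have [s sS Ss] := IHk S; exists s => // m /Ss[m0 m0s le0]; exists m0 => // i _.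
  exact: le0 (leq_trans (ltn_ord i) nk).
pose v := Ordinal kn.
have [s sS Ss] := IHk S.
pose D := \max_(m <- s) m v.
have /choice[t tP] d : exists t : seq 'X_{1..n},
    (forall m : 'X_{1..n}, m \in t -> S m /\ m v = d) /\
    forall m : 'X_{1..n}, S m -> m v = d -> exists2 m0, m0 \in t & lek k m0 m.
  have [t tS St] := IHk (fun m : 'X_{1..n} => S m /\ m v = d).
  by exists t; split=> // m Sm mv; apply: St.
exists (s ++ flatten [seq t d | d <- iota 0 D]).
  move=> m; rewrite mem_cat => /orP[/sS //|/flattenP[_ /mapP[d _ ->]]].
  by case: (tP d) => tS _ /tS[].
have lekS m0 m : lek k m0 m -> (m0 v <= m v)%N -> lek k.+1 m0 m.
  move=> le0 lev i; rewrite ltnS leq_eqVlt => /predU1P[ik|]; last exact: le0.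
  by have -> : i = v by apply: val_inj.
move=> m Sm; have [Dm|mD] := leqP D (m v).
  have [m0 m0s le0] := Ss m Sm; exists m0; first by rewrite mem_cat m0s.
  by apply: lekS => //; apply: leq_trans Dm; apply: leq_bigmax_seq.
have [_ /(_ m Sm erefl)[m0 m0t le0]] := tP (m v).
exists m0; last by apply: lekS => //; case: (tP (m v)) => /(_ m0 m0t)[_ ->].
rewrite mem_cat; apply/orP; right; apply/flattenP; exists (t (m v)) => //.
by apply/mapP; exists (m v) => //; rewrite mem_iota.
Qed.

Section InitialMonomials.
Variables (n : nat) (K : fieldType) (le : rel 'X_{1..n}).
Hypothesis hle : is_term_order le.
Implicit Types (m t : 'X_{1..n}) (f g : {mpoly K[n]}).
Implicit Types (I J W A B : set {mpoly K[n]}) (V : {set 'I_n}).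
Local Open Scope ring_scope.
Local Open Scope classical_set_scope.

Definition strict m1 m2 := le m1 m2 && (m1 != m2).
Local Notation lt := strict.
Local Notation initial := (is_initial_monomial le).

Lemma term_le_refl m : le m m.
Proof. by case: hle => tot _ _ _ _; have := tot m m; rewrite orbb. Qed.

Lemma strict_le m1 m2 : lt m1 m2 -> le m1 m2.
Proof. by case/andP. Qed.

Lemma strict_irr m : lt m m = false.
Proof. by rewrite /strict eqxx andbF. Qed.

Lemma term_le_trans m2 m1 m3 : le m1 m2 -> le m2 m3 -> le m1 m3.
Proof. by case: hle => _ _ tr _ _; apply: tr. Qed.

Lemma term_le_anti m1 m2 : le m1 m2 -> le m2 m1 -> m1 = m2.
Proof. by case: hle => _ anti _ _ _ le12 le21; apply: anti; rewrite le12. Qed.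

Lemma strict_trans m2 m1 m3 : lt m1 m2 -> le m2 m3 -> lt m1 m3.
Proof.
move=> /andP[le12 ne12] le23; rewrite /strict (term_le_trans le12 le23) /=.
by apply: contraNN ne12 => /eqP e13; apply/eqP/term_le_anti; rewrite // e13.
Qed.

Lemma term_leP m1 m2 : le m1 m2 \/ lt m2 m1.
Proof.
case: hle => tot _ _ _ _; have [->|ne] := eqVneq m1 m2; first by left; apply: term_le_refl.
by have /orP[|le21] := tot m1 m2; [left|right; rewrite /strict le21 eq_sym].
Qed.

Lemma term_le_addr m m1 m2 : le m1 m2 -> le (m1 + m)%MM (m2 + m)%MM.
Proof. by case: hle => _ _ _ _ addr; apply: addr. Qed.

Lemma term_le_add m1 m2 m3 m4 : le m1 m2 -> le m3 m4 ->
  le (m1 + m3)%MM (m2 + m4)%MM.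
Proof.
move=> le12 le34; apply: term_le_trans (term_le_addr _ le12) _.
by rewrite ![(m2 + _)%MM]addmC; apply: term_le_addr.
Qed.

Lemma strict_add m1 m2 m3 m4 : lt m1 m2 -> le m3 m4 ->
  lt (m1 + m3)%MM (m2 + m4)%MM.
Proof.
move=> /andP[le12 ne12] le34; apply: (@strict_trans (m2 + m3)%MM).
  by rewrite /strict term_le_addr // eqm_add2r.
exact: term_le_add (term_le_refl _) _.
Qed.

Lemma lem_term_le m1 m2 : (m1 <= m2)%MM -> le m1 m2.
Proof.
move=> le12; rewrite -(submK le12) -{1}[m1]add0m; apply: term_le_addr.
by case: hle.
Qed.

Lemma term_minimum (S : set 'X_{1..n}) m : S m ->
  exists2 m0, S m0 & forall m', S m' -> le m0 m'.
Proof.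
move=> Sm; have [s sS Ss] := dickson S.
have {m Sm Ss} [m ms Ss] : exists2 m, m \in s &
    forall m', S m' -> exists2 m0, m0 \in s & (m0 <= m')%MM.
  by have [m0 m0s _] := Ss m Sm; exists m0.
suff [m0 m0s min0] : exists2 m0, m0 \in s & forall m', m' \in s -> le m0 m'.
  exists m0; first exact: sS.
  by move=> m' /Ss[m1 /min0 le01 /lem_term_le]; apply: term_le_trans.
elim: s {sS Ss} m ms => [|a s IHs] m //= _.
case: s IHs => [_|b s /(_ b (mem_head _ _))[m0 m0s min0]].
  by exists a => [|m']; rewrite ?mem_head // inE => /eqP->; apply: term_le_refl.
have [le_am|/strict_le le_ma] := term_leP a m0.
  exists a => [|m']; rewrite ?mem_head // inE => /predU1P[->|/min0].
    exact: term_le_refl.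
  exact: term_le_trans.
by exists m0 => [|m']; rewrite inE ?m0s ?orbT // => /predU1P[->|/min0].
Qed.

Definition upto m f := forall m', m' \in msupp f -> le m' m.
Definition below m f := forall m', m' \in msupp f -> lt m' m.

Lemma below0 m : below m 0.
Proof. by move=> m'; rewrite msupp0. Qed.

Lemma belowD m f g : below m f -> below m g -> below m (f + g).
Proof.
by move=> bf bg m' /msuppD_le; rewrite mem_cat => /orP[/bf|/bg].
Qed.

Lemma belowN m f : below m f -> below m (- f).
Proof. by move=> bf m'; rewrite (perm_mem (msuppN f)) => /bf. Qed.

Lemma below_sum (T : Type) (r : seq T) (p : pred T) (F : T -> {mpoly K[n]}) m :
  (forall i, p i -> below m (F i)) -> below m (\sum_(i <- r | p i) F i).
Proof.
by move=> bF; apply: big_ind => // [|f g]; [apply: below0|apply: belowD].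
Qed.

Lemma below_upto m f : below m f -> upto m f.
Proof. by move=> bf m' /bf/strict_le. Qed.

Lemma below_le m1 m2 f : below m1 f -> le m1 m2 -> below m2 f.
Proof. by move=> bf le12 m' /bf; move/strict_trans; apply. Qed.

Lemma belowM m1 m2 f g : below m1 f -> upto m2 g -> below (m1 + m2)%MM (f * g).
Proof.
move=> bf ug m' /msuppM_le/allpairsP[[x y] /= [/bf xf /ug yg ->]].
exact: strict_add.
Qed.

Lemma uptoM m1 m2 f g : upto m1 f -> upto m2 g -> upto (m1 + m2)%MM (f * g).
Proof.
move=> uf ug m' /msuppM_le/allpairsP[[x y] /= [/uf xf /ug yg ->]].
exact: term_le_add.
Qed.

Lemma uptoZX c m : upto m (c *: 'X_[m] : {mpoly K[n]}).
Proof. by move=> m' /msuppZ_le; rewrite msuppX inE => /eqP->; apply: term_le_refl. Qed.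

Lemma upto_prod (T : Type) (r : seq T) (p : pred T) (F : T -> {mpoly K[n]})
    (d : T -> 'X_{1..n}) :
  (forall i, p i -> upto (d i) (F i)) ->
  upto (\sum_(i <- r | p i) d i)%MM (\prod_(i <- r | p i) F i).
Proof.
move=> uF; apply: (big_ind2 (fun m f => upto m f)) => //.
- by move=> m'; rewrite msupp1 inE => /eqP->; apply: term_le_refl.
- by move=> m1 f m2 g; apply: uptoM.
Qed.

Lemma initial_below f m : initial f m -> below m (f - f@_m *: 'X_[m]).
Proof.
move=> [fm mmax] m' m'f; have ne : m' != m.
  apply: contraTneq m'f => ->.
  by rewrite mcoeff_msupp mcoeffB mcoeffZ mcoeffX eqxx mulr1 subrr eqxx.
rewrite /strict ne andbT; apply: mmax; move: m'f.
by rewrite !mcoeff_msupp mcoeffB mcoeffZ mcoeffX [m == _]eq_sym (negPf ne) mulr0 subr0.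
Qed.

Lemma below_initial f m c : c != 0 -> below m (f - c *: 'X_[m]) -> initial f m.
Proof.
move=> c0 bf; have Ef : f = c *: 'X_[m] + (f - c *: 'X_[m]) by rewrite addrC subrK.
have cfm : (f - c *: 'X_[m])@_m = 0.
  by apply: memN_msupp_eq0; apply/negP => /bf; rewrite strict_irr.
split; first by rewrite mcoeff_msupp Ef mcoeffD cfm mcoeffZ mcoeffX eqxx mulr1 addr0.
move=> m'; rewrite Ef => /msuppD_le; rewrite mem_cat => /orP[|/bf/strict_le //].
exact: uptoZX.
Qed.

Lemma initialP f m : initial f m ->
  exists2 c, c != 0 & exists2 g, below m g & f = c *: 'X_[m] + g.
Proof.
move=> fm; exists f@_m; first by rewrite -mcoeff_msupp; case: fm.
by exists (f - f@_m *: 'X_[m]); [apply: initial_below|rewrite addrC subrK].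
Qed.

Lemma initialI c m g : c != 0 -> below m g -> initial (c *: 'X_[m] + g) m.
Proof. by move=> c0 bg; apply: (below_initial c0); rewrite addrAC subrr add0r. Qed.

Lemma initialX m : initial ('X_[m] : {mpoly K[n]}) m.
Proof.
by rewrite -['X_[m]]addr0 -['X_[m]]scale1r; apply: initialI; [exact: oner_neq0|exact: below0].
Qed.

Lemma initial1 : initial (1 : {mpoly K[n]}) 0%MM.
Proof. by rewrite -mpolyX0; apply: initialX. Qed.

Lemma initial_uniq f m1 m2 : initial f m1 -> initial f m2 -> m1 = m2.
Proof.
by move=> [f1 max1] [f2 max2]; apply: term_le_anti; [apply: max2|apply: max1].
Qed.

Lemma initial_neq0 f m : initial f m -> f != 0.
Proof. by move=> [fm _]; apply: contraTneq fm => ->; rewrite msupp0. Qed.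

Lemma initial_upto f m : initial f m -> upto m f.
Proof. by case. Qed.

Lemma initial_exists f : f != 0 -> exists m, initial f m.
Proof.
rewrite -msupp_eq0 => f0.
suff [m mf mmax] : exists2 m, m \in msupp f & forall m', m' \in msupp f -> le m' m.
  by exists m.
elim: (msupp f) f0 => // a [|b s] IHs _.
  by exists a => [|m']; rewrite ?mem_head // inE => /eqP->; apply: term_le_refl.
have [//|m0 m0s max0] := IHs; have [le_am|/strict_le le_ma] := term_leP a m0.
  by exists m0 => [|m']; rewrite inE ?m0s ?orbT // => /predU1P[->|/max0].
exists a => [|m']; rewrite ?mem_head // inE => /predU1P[->|/max0 le'].
  exact: term_le_refl.
exact: term_le_trans le_ma.
Qed.

Lemma initialM f g m1 m2 : initial f m1 -> initial g m2 ->
  initial (f * g) (m1 + m2)%MM.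
Proof.
move=> /initialP[c c0 [f' bf ->]] gm; have ug := initial_upto gm.
have /initialP[d d0 [g' bg Eg]] := gm.
have -> : (c *: 'X_[m1] + f') * g =
    (c * d) *: 'X_[m1 + m2] + (c *: 'X_[m1] * g' + f' * g).
  rewrite mulrDl {1}Eg mulrDr addrA; congr (_ + _ + _).
  by rewrite -scalerAl -scalerAr scalerA mpolyXD.
apply: initialI; first by rewrite mulf_neq0.
apply: belowD; last exact: belowM.
by rewrite mulrC addmC; apply: belowM => //; apply: uptoZX.
Qed.

Lemma below_initial_strict f m1 m2 : initial f m1 -> lt m1 m2 -> below m2 f.
Proof.
move=> /initialP[c c0 [f' bf ->]] lt12; apply: belowD; last first.
  by apply: below_le bf _; apply: strict_le.
by move=> m' /msuppZ_le; rewrite msuppX inE => /eqP->.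
Qed.

Lemma initialD f g m : initial f m -> below m g -> initial (f + g) m.
Proof.
move=> /initialP[c c0 [f' bf ->]] bg; rewrite -addrA; apply: initialI => //.
exact: belowD.
Qed.

Lemma initialMX f m m' : initial (f * 'X_[m']) (m + m')%MM -> initial f m.
Proof.
move=> ini; have [|m0 m0f] := @initial_exists f.
  by apply: contraTneq (initial_neq0 ini) => ->; rewrite mul0r eqxx.
have /eqP := initial_uniq ini (initialM m0f (initialX m')).
by rewrite eqm_add2r => /eqP->.
Qed.

Lemma initial_prod (T : Type) (r : seq T) (p : pred T) (F : T -> {mpoly K[n]})
    (d : T -> 'X_{1..n}) :
  (forall i, p i -> initial (F i) (d i)) ->
  initial (\prod_(i <- r | p i) F i) (\sum_(i <- r | p i) d i)%MM.
Proof.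
move=> iF; apply: (big_ind2 (fun f m => initial f m)) => //; first exact: initial1.
by move=> f m1 g m2; apply: initialM.
Qed.

Lemma cancel_initial f g m : initial f m -> initial g m ->
  exists2 c, c != 0 & below m (f - c *: g).
Proof.
move=> /initialP[c c0 [f' bf ->]] /initialP[d d0 [g' bg ->]]; exists (c / d).
  by rewrite mulf_neq0 ?invr_eq0.
rewrite scalerDr scalerA divfK // opprD addrACA subrr add0r.
apply: belowD => //; apply: belowN => m' /msuppZ_le; exact: bg.
Qed.

Lemma below_initial_lt f m m' : below m f -> initial f m' -> lt m' m.
Proof. by move=> bf [/bf]. Qed.

(** Term orders are well-founded by Dickson's lemma; this is the induction by which
    polynomials are reduced. *)
Lemma initial_induction (Pr : {mpoly K[n]} -> Prop) :
  (forall f, (forall m g, initial f m -> below m g -> Pr g) -> Pr f) ->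
  forall f, Pr f.
Proof.
move=> step f; apply: contrapT => nPf.
have bad g : ~ Pr g -> exists2 m, initial g m & exists2 h, below m h & ~ Pr h.
  move=> nPg; apply: contrapT => nobad; apply/nPg/step => m h gm bh.
  by apply: contrapT => nPh; apply: nobad; exists m => //; exists h.
have [m fm _] := bad f nPf.
have [|m0 [g nPg gm0] min0] :=
    @term_minimum [set m | exists2 f, ~ Pr f & initial f m] m.
  by exists f.
have [m1 gm1 [h bh nPh]] := bad g nPg.
rewrite (initial_uniq gm1 gm0) in bh.
have [m2 hm2 _] := bad h nPh.
have lt20 := below_initial_lt bh hm2.
have le02 : le m0 m2 by apply: min0; exists h.
by have := strict_trans lt20 le02; rewrite strict_irr.
Qed.

Definition InMon I m := exists2 f, I f & initial f m.

Lemma InMonD I m t : is_ideal I -> InMon I m -> InMon I (t + m)%MM.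
Proof.
move=> II [f If fm]; exists ('X_[t] * f); first exact: is_idealM.
by apply: initialM => //; apply: initialX.
Qed.

Lemma InMon_lem I m1 m2 : is_ideal I -> InMon I m1 -> (m1 <= m2)%MM -> InMon I m2.
Proof. by move=> II I1 le12; rewrite -(submK le12); apply: InMonD. Qed.

Lemma InMonS I J m : I `<=` J -> InMon I m -> InMon J m.
Proof. by move=> IJ [f /IJ Jf fm]; exists f. Qed.

Lemma is_idealZ I c f : is_ideal I -> I f -> I (c *: f).
Proof. by move=> II If; rewrite -mul_mpolyC; apply: is_idealM. Qed.

Lemma initial_idealE I f : is_ideal I ->
  initial_ideal le I f <-> forall m, m \in msupp f -> InMon I m.
Proof.
move=> II; split=> [|If].
  move=> /(_ [set g | forall m, m \in msupp g -> InMon I m]); apply; last first.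
    by move=> _ [m Im <-] m'; rewrite msuppX inE => /eqP->.
  split=> [m|g h Ig Ih m|a g Ig m] /=.
  - by rewrite msupp0.
  - by move=> /msuppD_le; rewrite mem_cat => /orP[/Ig|/Ih].
  - by move=> /msuppM_le/allpairsP[[x y] /= [_ /Ig Iy ->]]; apply: InMonD.
rewrite (mpolyE f) big_seq; have GI : is_ideal (initial_ideal le I) by apply: ideal_genP.
apply: (is_ideal_sum _ GI) => m /If Im; rewrite -mul_mpolyC; apply: (is_idealM GI).
by apply: sub_ideal_gen; exists m.
Qed.

Lemma below_normal_form I f : is_ideal I ->
  exists2 g, I g & f - g = 0 \/ exists2 m, initial (f - g) m & ~ InMon I m.
Proof.
move=> II; elim/initial_induction: f => f IHf.
have [->|f0] := eqVneq f 0.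
  by exists 0; [apply: is_ideal0|left; rewrite subrr].
have [m fm] := initial_exists f0.
have [[h Ih hm]|nIm] := pselect (InMon I m); last first.
  by exists 0; [apply: is_ideal0|right; exists m; rewrite ?subr0].
have [c _ bfh] := cancel_initial fm hm.
have [g Ig fgP] := IHf m (f - c *: h) fm bfh.
exists (c *: h + g); first by apply: is_idealD => //; apply: is_idealZ.
by rewrite opprD addrA.
Qed.

Definition is_groebner r (w : 'I_r -> {mpoly K[n]}) (d : 'I_r -> 'X_{1..n}) W :=
  [/\ forall j, W (w j), forall j, initial (w j) (d j) &
      forall m, InMon W m -> exists j, (d j <= m)%MM].

Lemma groebner_exists W : exists r w d, @is_groebner r w d W.
Proof.
have [s sW Ws] := dickson (InMon W).
have /choice[w wP] (j : 'I_(size s)) : exists f, W f /\ initial f (nth 0%MM s j).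
  by have [f Wf fm] := sW _ (mem_nth 0%MM (ltn_ord j)); exists f.
exists (size s), w, (fun j => nth 0%MM s j); split=> [j|j|m /Ws[m0 m0s le0]].
- by case: (wP j).
- by case: (wP j).
- have ltm0 : (index m0 s < size s)%N by rewrite index_mem.
  by exists (Ordinal ltm0); rewrite /= nth_index.
Qed.

(** Division by a Groebner basis, with the bound on the quotients that makes
    the initial monomials of the summands decrease. *)
Lemma groebner_division r w d W f : is_ideal W -> @is_groebner r w d W -> W f ->
  exists2 b : 'I_r -> {mpoly K[n]}, f = \sum_j b j * w j &
    forall m, below m f -> forall j, below m (b j * 'X_[d j]).
Proof.
move=> WW [wW wd dW]; elim/initial_induction: f => f IHf Wf.
have [->|f0] := eqVneq f 0.
  exists (fun=> 0) => [|m _ j]; last by rewrite mul0r; apply: below0.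
  by rewrite big1 // => j _; rewrite mul0r.
have [m fm] := initial_exists f0; have [|j le_j] := dW m; first by exists f.
have [|c _ bf] := @cancel_initial f ('X_[m - d j] * w j) m fm.
  by rewrite -{2}(submK le_j); apply: initialM => //; apply: initialX.
have [|b Eb bb] := IHf m _ fm bf.
  by apply: is_idealB => //; apply: is_idealZ => //; apply: is_idealM.
exists (fun k => b k + (if k == j then c *: 'X_[m - d j] else 0)) => [|m' bf' k].
  under eq_bigr do rewrite mulrDl; rewrite big_split /= -Eb (bigD1 j) //= eqxx.
  rewrite big1 ?addr0 => [|k /negPf->]; last by rewrite mul0r.
  by rewrite -scalerAl subrK.
rewrite mulrDl; apply: belowD.
  by apply: below_le (bb m bf k) _; apply: strict_le; apply: below_initial_lt bf' fm.
case: eqP => [->|_]; last by rewrite mul0r; apply: below0.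
rewrite -scalerAl -mpolyXD submK // => m2 /msuppZ_le; rewrite msuppX inE => /eqP->.
exact: below_initial_lt bf' fm.
Qed.

Lemma ideal_fin_gen W : is_ideal W -> is_fin_gen W.
Proof.
move=> WW; have [r [w [d wdW]]] := groebner_exists W.
exists (codom w); have GI := ideal_genP [set` codom w]; apply/seteqP; split=> f.
  move=> Wf; have [b -> _] := groebner_division WW wdW Wf.
  apply: (is_ideal_sum _ GI) => j _; apply: (is_idealM GI).
  by apply: sub_ideal_gen; rewrite /= codom_f.
by move=> /(_ W WW); apply=> _ /codomP[j ->]; case: wdW.
Qed.

Lemma radical_initial I : is_ideal I ->
  (forall m, InMon I (m + m)%MM -> InMon I m) -> is_radical I.
Proof.
move=> II Irad f; elim/initial_induction: f => f IHf If2.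
have [->|f0] := eqVneq f 0; first exact: is_ideal0.
have [m fm] := initial_exists f0.
have [|g Ig gm] := Irad m.
  by exists (f ^+ 2); rewrite // expr2; apply: initialM.
have [c _ bfg] := cancel_initial fm gm.
have Icg : I (c *: g) by apply: is_idealZ.
rewrite -[f](subrK (c *: g)); apply: is_idealD => //; apply: IHf fm bfg _.
have -> : (f - c *: g) ^+ 2 = f ^+ 2 + (c *: g - f *+ 2) * (c *: g) by ring.
by apply: is_idealD => //; apply: is_idealM.
Qed.

(** If [f = a + b] with [a * b] in [I], then [a ^+ 2] is congruent to [f * a]
    modulo [I]. Hence, as long as the initial monomial of [a] exceeds that of
    [f], its square is initial in [I]; by radicality it is itself initial in
    [I], and subtracting an element of [I] lowers it. Once it is at most that of
    [f], the latter is initial for [a] or for [b]. *)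
Lemma initial_sum I A B m : is_ideal I -> is_ideal A -> is_ideal B ->
    (forall m, InMon I (m + m)%MM -> InMon I m) ->
    I `<=` A -> I `<=` B -> (forall a b, A a -> B b -> I (a * b)) ->
  InMon (ideal_sum A B) m -> InMon A m \/ InMon B m.
Proof.
move=> II AA BB Irad IA IB AB [f [a Aa [b Bb fE]] fm].
elim/initial_induction: a b Aa Bb fE => a IHa b Aa Bb fE.
have bE : b = f - a by rewrite -fE addrC addKr.
have main : upto m a -> InMon A m \/ InMon B m.
  move=> ua; have [am|nam] := boolP (m \in msupp a); first by left; exists a.
  right; exists b => //; split.
    rewrite mcoeff_msupp bE mcoeffB (memN_msupp_eq0 nam) subr0.
    by rewrite -mcoeff_msupp; case: fm.
  move=> m'; rewrite bE => /msuppB_le; rewrite mem_cat => /orP[|/ua //].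
  exact: initial_upto.
have [a0|a0] := eqVneq a 0; first by apply: main => m'; rewrite a0 msupp0.
have [m1 am1] := initial_exists a0.
have [le1|lt1] := term_leP m1 m.
  by apply: main => m' /(initial_upto am1) le'; apply: term_le_trans le1.
have [|g Ig gm1] := Irad m1.
  exists (a * - b).
    by rewrite mulrN; apply: is_idealN => //; apply: AB.
  rewrite bE opprB mulrBr; apply: initialD; first exact: initialM.
  apply: belowN; rewrite mulrC; apply: belowM (initial_upto am1).
  by move=> m' /(initial_upto fm) le'; case/andP: (lt1) => _ ne;
     rewrite /strict (term_le_trans le' (strict_le lt1));
     apply: contraNN ne => /eqP e'; apply/eqP; apply: term_le_anti;
     rewrite ?(strict_le lt1) // -e'.
have [c _ bag] := cancel_initial am1 gm1.
have Icg : I (c *: g) by apply: is_idealZ.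
apply: (IHa m1 (a - c *: g) am1 bag (b + c *: g)).
- by apply: is_idealB => //; apply: IA.
- by apply: is_idealD => //; apply: IB.
- by rewrite addrACA addNr addr0.
Qed.

Definition hit V m := [exists i in V, m i != 0%N].

Lemma hitP V m : reflect (exists2 i, i \in V & m i != 0%N) (hit V m).
Proof. exact: exists_inP. Qed.

Lemma hit0 V : hit V 0%MM = false.
Proof. by apply/hitP => -[i _]; rewrite mnm0E. Qed.

Lemma hitD V m1 m2 : hit V (m1 + m2)%MM = hit V m1 || hit V m2.
Proof.
apply/hitP/orP => [[i iV]|[] /hitP[i iV mi]].
- by rewrite mnmDE addn_eq0 negb_and => /orP[mi|mi]; [left|right]; apply/hitP; exists i.
- by exists i => //; rewrite mnmDE addn_eq0 negb_and mi.
- by exists i => //; rewrite mnmDE addn_eq0 negb_and mi orbT.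
Qed.

Lemma hit_sum V (T : finType) (d : T -> 'X_{1..n}) :
  (forall j, ~~ hit V (d j)) -> ~~ hit V (\sum_j d j)%MM.
Proof.
move=> nh; apply: (big_ind (fun m => ~~ hit V m)) => //; first by rewrite hit0.
by move=> m1 m2; rewrite hitD negb_or => -> ->.
Qed.

(** Nakayama's lemma for the localization that inverts the polynomials whose
    initial monomial misses [V]. Clearing initial monomials in a Groebner basis of [W]
    gives a square system over [I] whose determinant is dominated by its
    diagonal, hence has an initial monomial missing [V]. *)
Lemma initial_nakayama I W V : is_ideal I -> is_ideal W -> I `<=` W ->
    (forall m, InMon W m -> exists2 t, ~~ hit V t & InMon I (t + m)%MM) ->
  exists2 d, (exists2 m, initial d m & ~~ hit V m) & colon I W d.
Proof.
move=> II WW IW WI; have [r [w [d wdW]]] := groebner_exists W.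
have [wW wd _] := wdW.
have /choice[t tP] j : exists t, ~~ hit V t /\ InMon I (t + d j)%MM.
  by have [|t nt It] := WI (d j); [exists (w j)|exists t].
have /choice[b bP] j : exists b : 'I_r -> {mpoly K[n]},
    I ('X_[t j] * w j - \sum_l b l * w l) /\
    forall l, below (t j + d j)%MM (b l * 'X_[d l]).
  have [_ [g Ig gm]] := tP j.
  have [|c _ bg] := @cancel_initial ('X_[t j] * w j) g _ _ gm.
    by apply: initialM => //; apply: initialX.
  have Icg : I (c *: g) by apply: is_idealZ.
  have [|b Eb bb] := groebner_division WW wdW (f := 'X_[t j] * w j - c *: g).
    by apply: is_idealB => //; [apply: is_idealM|apply: IW].
  by exists b; split; [rewrite -Eb subKr|apply: bb].
pose B : 'M[{mpoly K[n]}]_r :=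
  \matrix_(j, l) ((if j == l then 'X_[t j] else 0) - b j l).
have rowB j : I (\sum_l B j l * w l).
  have [Ij _] := bP j; rewrite (_ : \sum_l _ = 'X_[t j] * w j - \sum_l b j l * w l) //.
  under eq_bigr do rewrite mxE mulrBl; rewrite big_split /= sumrN; congr (_ - _).
  rewrite (bigD1 j) //= eqxx big1 ?addr0 // => l /negPf.
  by rewrite eq_sym => ->; rewrite mul0r.
exists (\det B); last first.
  move=> x /(groebner_division WW wdW)[a -> _]; rewrite mulr_sumr.
  apply: is_ideal_sum => // j _; rewrite mulrCA; apply: is_idealM => //.
  have -> : \det B * w j = \sum_k (\adj B) j k * \sum_l B k l * w l.
    transitivity (\sum_l (\adj B *m B) j l * w l).
      rewrite mul_adj_mx (bigD1 j) //= big1 ?addr0 => [|l /negPf jl].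
        by rewrite mxE eqxx mulr1n.
      by rewrite mxE eq_sym jl mul0r.
    under eq_bigr do rewrite mxE mulr_suml.
    rewrite exchange_big; apply: eq_bigr => k _; rewrite mulr_sumr.
    by apply: eq_bigr => l _; rewrite mulrA.
  by apply: is_ideal_sum => // k _; apply: is_idealM => //; apply: rowB.
exists (\sum_j t j)%MM; last by apply: hit_sum => j; case: (tP j).
(* Weighting the columns by the initial monomials of the basis bounds every
   entry of a row by that of the diagonal. *)
apply: (@initialMX _ _ (\sum_j d j)%MM); rewrite -big_split /=.
have diagB j : initial (B j j * 'X_[d j]) (t j + d j)%MM.
  rewrite mxE eqxx mulrBl; apply: initialD.
    by rewrite -mpolyXD; apply: initialX.
  by apply: belowN; case: (bP j).
have offB j l : j != l -> below (t j + d j)%MM (B j l * 'X_[d l]).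
  by move=> /negPf jl; rewrite mxE jl sub0r mulNr; apply: belowN; case: (bP j).
have uptoB j l : upto (t j + d j)%MM (B j l * 'X_[d l]).
  have [<-|/offB/below_upto //] := eqVneq j l; exact: initial_upto.
have weigh (s : 'S_r) : (\prod_j B j (s j)) * 'X_[\sum_j d j] =
    \prod_j (B j (s j) * 'X_[d (s j)]).
  rewrite big_split /= -mprodXE; congr (_ * _).
  by rewrite (reindex_inj (@perm_inj _ s)).
rewrite /determinant (bigD1 (1%g : 'S_r)) //= odd_perm1 expr0 mul1r mulrDl.
apply: initialD.
  rewrite weigh; under eq_bigr do rewrite perm1.
  exact: initial_prod.
rewrite mulr_suml; apply: below_sum => s s1.
rewrite -mulrA weigh; have [j sj] : exists j, j != s j.
  apply: contrapT => nos; case/eqP: s1; apply/permP => j; rewrite perm1.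
  by apply: contrapT => sj; apply: nos; exists j; apply/eqP => /esym.
suff bs : below (\sum_j (t j + d j))%MM (\prod_j (B j (s j) * 'X_[d (s j)])).
  by rewrite -signr_odd; case: (odd _); rewrite ?expr0 ?mul1r // expr1 mulN1r; apply: belowN.
rewrite (bigD1 j) //= [\prod_i _](bigD1 j) //=.
by apply: belowM; [apply: offB|apply: upto_prod].
Qed.
End InitialMonomials.

(** * Upper bounds on chains of primes *)

Section FreeFamilies.
Variables (n : nat) (K : fieldType).
Implicit Types (P Q : set {mpoly K[n]}) (m : 'X_{1..n}) (g : {mpoly K[n]}).
Local Open Scope ring_scope.
Local Open Scope classical_set_scope.

Definition free_mod P (T : finType) (e : T -> {mpoly K[n]}) :=
  forall c : T -> K, P (\sum_j c j *: e j) -> forall j, c j = 0.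

(** In a relation modulo [P], the lowest power of [g] can be cancelled because [g]
    is outside [P]; modulo [Q] only its coefficient then remains. *)
Lemma free_mod_powers P Q g (T : finType) (e : T -> {mpoly K[n]}) D :
    is_prime_ideal P -> is_prime_ideal Q -> P `<=` Q -> Q g -> ~ P g ->
    free_mod Q e ->
  free_mod P (fun x : T * 'I_D => e x.1 * g ^+ x.2).
Proof.
move=> PP QQ PQ Qg nPg eQ c.
have IP := prime_is_ideal PP; have IQ := prime_is_ideal QQ.
have -> : \sum_x c x *: (e x.1 * g ^+ x.2) =
    \sum_j \sum_(i < D) c (j, i) *: (e j * g ^+ i).
  by rewrite pair_bigA; apply: eq_bigr => -[].
rewrite exchange_big /= => Psum [j i] /=.
suff vanish (b : T -> nat -> K) :
    P (\sum_(i < D) (\sum_j b j i *: e j) * g ^+ i) -> forall j (i : 'I_D), b j i = 0.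
  pose b j i := if insub i is Some i' then c (j, i') else 0.
  have bE j' (i' : 'I_D) : b j' i' = c (j', i') by rewrite /b valK.
  rewrite -bE; apply: vanish.
  under eq_bigr do rewrite mulr_suml.
  by under eq_bigr do under eq_bigr do rewrite bE -scalerAl.
elim: D b {c j i Psum} => [b _ _ [] //|D IHD b].

rewrite big_ord_recl expr0 mulr1.
under [X in _ + X]eq_bigr do rewrite lift0 exprS mulrCA.
rewrite -mulr_sumr => Psum.
have b0 j : b j 0%N = 0.
  apply: (eQ (b^~ 0%N)).
  rewrite -[X in Q X](addrK (g * \sum_(i < D) (\sum_j b j i.+1 *: e j) * g ^+ i)).
  by apply: is_idealB => //; [apply: PQ|apply: is_idealMr].
move=> j i; case: (unliftP ord0 i) => [i' ->|->]; last exact: b0.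
apply: (IHD (fun j i => b j i.+1)); move: Psum.
by rewrite big1 ?add0r => [/(prime_mul PP)[]|j' _] //; rewrite b0 scale0r.
Qed.

Lemma free_mod_card P (T : finType) (e : T -> {mpoly K[n]}) D : is_ideal P ->
    (forall j m, m \in msupp (e j) -> (mdeg m <= D)%N) -> free_mod P e ->
  (#|T| <= D.+1 ^ n)%N.
Proof.
move=> IP eD eP; pose M := {ffun 'I_n -> 'I_D.+1}.
pose mon (k : 'I_#|{: M}|) := [multinom (enum_val k i : nat) | i < n].
pose A : 'M[K]_(#|T|, #|{: M}|) := \matrix_(j, k) (e (enum_val j))@_(mon k).
suff : row_free A.
  rewrite /row_free => /eqP <-.
  by apply: leq_trans (rank_leq_col A) _; rewrite card_ffun !card_ord.
apply: inj_row_free => v vA; apply/rowP => j; rewrite mxE.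
rewrite -(enum_valK j); apply: (eP (fun x => v ord0 (enum_rank x))).
suff -> : \sum_x v ord0 (enum_rank x) *: e x = 0 by apply: is_ideal0.
apply/mpolyP => m; rewrite mcoeff0 raddf_sum /=.
have [[k mk]|nk] := pselect (exists k, m = mon k).
  move/rowP: vA => /(_ k); rewrite !mxE => vAk; apply: etrans vAk.
  rewrite (reindex (@enum_val T T)) /=; last exact/onW_bij/enum_val_bij.
  by apply: eq_bigr => i _; rewrite mcoeffZ enum_valK mxE mk.
apply: big1 => x _; rewrite mcoeffZ memN_msupp_eq0 ?mulr0 //.
apply/negP => /eD mD; apply: nk.
have mi i : (m i < D.+1)%N.
  by rewrite ltnS; apply: leq_trans mD; rewrite mdegE (bigD1 i) //= leq_addr.
exists (enum_rank [ffun i => Ordinal (mi i)]); apply/mnmP => i.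
by rewrite mnmE enum_rankK ffunE.
Qed.

End FreeFamilies.

Section Heights.
Variables (n : nat) (K : fieldType) (le : rel 'X_{1..n}).
Hypothesis hle : is_term_order le.
Implicit Types (I J P : set {mpoly K[n]}) (m : 'X_{1..n}) (V : {set 'I_n}).
Local Open Scope ring_scope.
Local Open Scope classical_set_scope.
Local Notation initial := (is_initial_monomial le).
Local Notation InMon := (InMon le).

(** The polynomials whose initial monomial misses [V] form a multiplicative set. *)
Lemma prime_hitting J V : is_ideal J -> (forall m, InMon J m -> hit V m) ->
  exists P, [/\ is_prime_ideal P, J `<=` P & forall m, InMon P m -> hit V m].
Proof.
move=> JJ JV.
have [||||P [PP JP PV]] :=
    @prime_avoiding _ J [set d | exists2 m, initial d m & ~~ hit V m].
- by [].
- by exists 0%MM; [apply: initial1|rewrite hit0].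
- move=> x y [mx xm nx] [my ym ny]; exists (mx + my)%MM; first exact: initialM.
  by rewrite hitD negb_or nx.
- by move=> x Jx [m xm]; apply/negP; rewrite negbK; apply: JV; exists x.
exists P; split=> // m [f Pf fm]; apply: contrapT => /negP nhit.
by apply: (PV f) => //; exists m.
Qed.

Definition mon_off V D (x : {ffun {i | i \notin V} -> 'I_D}) : 'X_{1..n} :=
  [multinom (if insub i is Some i' then x i' : nat else 0%N) | i < n].

Lemma monomials_free V P D : is_ideal P -> (forall m, InMon P m -> hit V m) ->
  free_mod P (fun x => 'X_[@mon_off V D x]).
Proof.
set mon := @mon_off V D => IP PV c Pc.
have mon_inj : injective mon.
  move=> x y /mnmP xy; apply/ffunP => -[i iV]; apply/val_inj.
  by have := xy i; rewrite !mnmE insubT.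
have nhit x : ~~ hit V (mon x).
  by apply/hitP => -[i iV]; rewrite mnmE insubF ?eqxx //= iV.
have coef x : (\sum_y c y *: 'X_[mon y])@_(mon x) = c x.
  rewrite raddf_sum (bigD1 x) //= mcoeffZ mcoeffX eqxx mulr1 big1 ?addr0 // => y yx.
  by rewrite mcoeffZ mcoeffX (inj_eq mon_inj) (negPf yx) mulr0.
have supp m : m \in msupp (\sum_y c y *: 'X_[mon y]) -> exists x, m = mon x.
  rewrite mcoeff_msupp => nz; apply: contrapT => nox; case/eqP: nz.
  rewrite raddf_sum /= big1 // => y _; rewrite mcoeffZ mcoeffX.
  by case: eqP => [my|_]; [case: nox; exists y|rewrite mulr0].
move=> x; rewrite -coef; have [->|nz] := eqVneq (\sum_y c y *: 'X_[mon y]) 0.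
  exact: mcoeff0.
have [m ini] := initial_exists hle nz; have [y my] := supp m (proj1 ini).
have : hit V m by apply: PV; exists (\sum_y c y *: 'X_[mon y]).
by rewrite my (negPf (nhit y)).
Qed.

(** Each step down the chain multiplies the size of a family that is free modulo
    the prime by a number [D], while the degrees remain linear in [D]; too long
    a chain would produce too many independent polynomials. *)
Lemma chain_length P V k : (forall m, InMon P m -> hit V m) -> has_chain P k ->
  (k <= #|V|)%N.
Proof.
move=> PV [c [cP cprime cS]].
have fam i : (i <= k)%N -> exists B, forall D,
    exists (T : finType) (e : T -> {mpoly K[n]}),
    [/\ #|T| = (D ^ (n - #|V| + i))%N, free_mod (c (k - i)%N) e &
        forall j m, m \in msupp (e j) -> (mdeg m <= D * B)%N].
  elim: i => [_|i IHi ik].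
    exists n => D; rewrite subn0 cP.
    exists {ffun {i | i \notin V} -> 'I_D}; eexists; split; last 2 first.
    - apply: monomials_free PV; rewrite -cP; apply: prime_is_ideal; exact: cprime.
    - move=> x m; rewrite msuppX inE => /eqP->; rewrite mdegE.
      rewrite mulnC -[X in (_ <= X * _)%N]card_ord -sum_nat_const.
      apply: leq_sum => j _; rewrite mnmE; case: insubP => // j' _ _.
      exact: ltnW.
    - rewrite card_ffun card_ord addn0; congr (_ ^ _)%N.
      have VC := cardC (mem V); rewrite card_ord in VC.
      apply: etrans (congr1 (subn^~ #|V|) VC); rewrite addKn card_sig.
      exact: eq_card.
  have [B bB] := IHi (ltnW ik).
  have lt_c : c (k - i.+1)%N `<` c (k - i)%N.
    by rewrite -(subnSK ik); apply: cS; lia.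
  have [sub /existsNP[g /not_implyP[Qg nPg]]] := lt_c.
  exists (B + msize g)%N => D; have [T [e [cardT eQ eB]]] := bB D.
  exists (T * 'I_D)%type, (fun x : T * 'I_D => e x.1 * g ^+ x.2); split.
  - by rewrite card_prod cardT card_ord addnS expnSr.
  - by apply: free_mod_powers sub Qg nPg eQ; apply: cprime; rewrite leq_subr.
  - move=> [j d] m /= /msuppM_le/allpairsP[[x y] /= [/eB xB yg ->]].
    rewrite mdegD mulnDr leq_add //.
    have {yg} : (mdeg y <= d * msize g)%N.
      elim: {d} (d : nat) y yg => [|d IHd] y.
        by rewrite expr0 msupp1 inE => /eqP->; rewrite mdeg0.
      rewrite exprS => /msuppM_le/allpairsP[[x' y'] /= [xg /IHd yd ->]].
      by rewrite mdegD mulSn leq_add // ltnW // msize_mdeg_lt.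
    by move=> /leq_trans; apply; rewrite leq_mul2r ltnW ?orbT.
rewrite leqNgt; apply/negP => Vk; have [B bB] := fam k (leqnn k).
pose D := ((B.+1) ^ n).+1.
have [T [e [cardT e0 eB]]] := bB D; rewrite subnn in e0.
have := free_mod_card (prime_is_ideal (cprime 0%N isT)) eB e0; rewrite cardT leqNgt.
have VN : (#|V| <= n)%N by rewrite -[n in (_ <= n)%N]card_ord max_card.
apply/negP; rewrite negbK; apply: (@leq_ltn_trans ((D * B.+1) ^ n)).
  by case: (n) => // N; rewrite leq_exp2r // mulnS addnC -addn1 leq_add2l.
apply: (@leq_trans (D ^ n.+1)); last by rewrite leq_pexp2l //; lia.
by rewrite expnMn expnSr ltn_pmul2l // expn_gt0.
Qed.

Definition coprime_mon m1 m2 := forall i, m1 i = 0%N \/ m2 i = 0%N.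

Lemma coprime_lem m1 m2 m : coprime_mon m1 m2 ->
  (m1 <= m + m2)%MM -> (m1 <= m)%MM.
Proof.
move=> co /mnm_lepP le12; apply/mnm_lepP => i; have := le12 i.
by rewrite mnmDE; case: (co i) => ->; rewrite ?addn0.
Qed.

(** Buchberger's coprimality criterion: polynomials with pairwise coprime initial
    monomials are a Groebner basis and a regular sequence. Both follow by
    reducing the coefficient of the last polynomial modulo the previous ones. *)
Lemma coprime_regular (fs : seq {mpoly K[n]}) (u : nat -> 'X_{1..n}) :
    (forall i, (i < size fs)%N -> initial fs`_i (u i)) ->
    (forall i, (i < size fs)%N -> u i <> 0%MM) ->
    (forall i j, (i < size fs)%N -> (j < i)%N -> coprime_mon (u j) (u i)) ->
  is_regular_seq fs.
Proof.
move=> fu u0 co; pose G i := ideal_gen [set` take i fs].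
have GI i : is_ideal (G i) by apply: ideal_genP.
have Gu i j : (i <= size fs)%N -> (j < i)%N -> InMon (G i) (u j).
  move=> le_i lt_j; exists fs`_j; last exact: fu (leq_trans lt_j le_i).
  apply: sub_ideal_gen; rewrite /= -(nth_take _ lt_j) mem_nth // size_take.
  by case: ifP => // _; exact: leq_trans le_i.
have Gmon i : (i <= size fs)%N -> forall m, InMon (G i) m ->
    exists2 j, (j < i)%N & (u j <= m)%MM.
  elim: i => [_ m [f Gf fm]|i IHi ltis m [f Gf fm]].
    case: fm; suff -> : f = 0 by rewrite msupp0.
    apply: (Gf [set 0]); first split=> //=.
    - by move=> x y -> ->; rewrite addr0.
    - by move=> a x ->; rewrite mulr0.
    - by rewrite take0 => x.
  have IH := IHi (ltnW ltis); have Gui j : (j < i)%N -> _ := Gu i j (ltnW ltis).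
  have widen m' : InMon (G i) m' -> exists2 j, (j < i.+1)%N & (u j <= m')%MM.
    by move=> /IH[j ji le_j]; exists j => //; apply: ltnW.
  move: Gf; rewrite /G (take_nth 0) // => /ideal_gen_rcons[a [y Gy fE]].
  have [b Gb ab] := below_normal_form hle a (GI i).
  have {}fE : f = (a - b) * fs`_i + (b * fs`_i + y) by rewrite fE; ring.
  set r := a - b in ab fE; set z := b * fs`_i + y in fE.
  have Gz : G i z by apply: (is_idealD (GI i)) => //; exact: is_idealMr (GI i) _.
  case: ab => [r0|[mr rmr nGmr]].
    by apply: widen; exists f => //; rewrite fE r0 mul0r add0r.
  have rfm := initialM hle rmr (fu i ltis).
  have [z0|/(initial_exists hle)[mz zmz]] := eqVneq z 0.
    exists i => //; suff -> : m = (mr + u i)%MM by apply: lem_addl.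
    by apply: (initial_uniq hle fm); rewrite fE z0 addr0.
  have Gmz : InMon (G i) mz by exists z.
  have ne : (mr + u i)%MM != mz.
    apply/eqP => eqm; have [j ji] := IH mz Gmz; rewrite -eqm => /coprime_lem le_j.
    by apply: nGmr; apply: InMon_lem (Gui j ji) (le_j (co i j ltis ji)).
  case: (term_leP hle mz (mr + u i)%MM) => [le_m|lt_m].
    have lt_m : strict le mz (mr + u i)%MM by rewrite /strict le_m eq_sym.
    exists i => //; suff -> : m = (mr + u i)%MM by apply: lem_addl.
    apply: (initial_uniq hle fm); rewrite fE; apply: initialD => //.
    exact: below_initial_strict zmz lt_m.
  apply: widen; suff -> : m = mz by [].
  apply: (initial_uniq hle fm); rewrite fE addrC; apply: initialD => //.
  exact: below_initial_strict rfm lt_m.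
split=> [G1|i x ltis Gfx].
  have [||j lt_j /mnm_lepP uj0] := Gmon (size fs) _ 0%MM; first by [].
    by exists 1; [rewrite /G take_size|apply: initial1].
  by apply: (u0 j lt_j); apply/mnmP => v; apply/eqP; have := uj0 v; rewrite mnm0E leqn0.
have [y Gy [/subr0_eq->//|[m xm nGm]]] := below_normal_form hle x (GI i).
have [||j ji le_j] := Gmon i _ (m + u i)%MM; first exact: ltnW.
  exists ((x - y) * fs`_i); last by apply: initialM => //; apply: fu.
  rewrite mulrBl mulrC; apply: (is_idealB (GI i)) => //; exact: is_idealMr (GI i) _.
case: nGm; apply: InMon_lem (Gu i j (ltnW ltis) ji) _ => //.
by apply: coprime_lem le_j; apply: co.
Qed.
End Heights.

(** * Square-free monomial complete intersections *)

Section SquarefreeMonomials.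
Variable n : nat.
Implicit Types (A : {set 'I_n}) (m : 'X_{1..n}).

Definition mono A : 'X_{1..n} := [multinom (i \in A : nat) | i < n].

Lemma mono_lemP A m : reflect (forall i, i \in A -> m i != 0%N) (mono A <= m)%MM.
Proof.
apply: (iffP mnm_lepP) => [leA i iA|mA i].
  by have := leA i; rewrite mnmE iA -lt0n.
by rewrite mnmE; case: (boolP (i \in A)) => // /mA; rewrite -lt0n.
Qed.

Lemma mono_lem A1 A2 : (mono A1 <= mono A2)%MM = (A1 \subset A2).
Proof.
apply/mono_lemP/fintype.subsetP => sub i /sub; rewrite mnmE; by case: (i \in A2).
Qed.

Lemma hit_mono (V : {set 'I_n}) A : [disjoint A & V] -> ~~ hit V (mono A).
Proof.
move=> /disjoint_setI0 AV; apply/hitP => -[i iV]; rewrite mnmE.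
case: (boolP (i \in A)) => // iA; have : i \in (A :&: V)%SET by rewrite inE iA.
by rewrite AV inE.
Qed.

End SquarefreeMonomials.

(** For the initial ideal of [I], this is what being a square-free monomial complete
    intersection amounts to. *)
Definition disjoint_initial n (K : fieldType) (le : rel 'X_{1..n})
    (I : set {mpoly K[n]}) h (A : 'I_h -> {set 'I_n}) :=
  [/\ forall m, InMon le I m <-> exists j, (mono (A j) <= m)%MM,
      forall i j v, v \in A i -> v \in A j -> i = j &
      forall j, A j != finset.set0].

Section CompleteIntersection.
Variables (n : nat) (K : fieldType) (le : rel 'X_{1..n}).
Hypothesis hle : is_term_order le.
Variable I : set {mpoly K[n]}.
Hypothesis hI : is_ideal I.
Hypothesis hsqf : is_squarefree_monomial_ideal (initial_ideal le I).
Local Open Scope ring_scope.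
Local Open Scope classical_set_scope.
Local Notation InMon := (InMon le).
Local Notation J := (initial_ideal le I).
Implicit Types (m : 'X_{1..n}) (A B C : {set 'I_n}).

Lemma initial_idealX m : J 'X_[m] <-> InMon I m.
Proof.
rewrite initial_idealE //; split=> [|Im m']; first by apply; rewrite msuppX mem_head.
by rewrite msuppX inE => /eqP->.
Qed.

Definition min_supports : {set {set 'I_n}} :=
  [set A | minset (fun A => `[< InMon I (mono A) >]) A]%SET.

Lemma min_supportsP A : A \in min_supports -> InMon I (mono A).
Proof. by rewrite inE => /minsetp/asboolP. Qed.

Lemma min_supports_min A B : B \in min_supports -> InMon I (mono A) ->
  A \subset B -> A = B.
Proof. by rewrite inE => /minsetP[_ Bmin] IA /Bmin; apply; apply/asboolP. Qed.

Lemma min_supports_lem m : InMon I m ->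
  exists2 A, A \in min_supports & (mono A <= m)%MM.
Proof.
move=> Im; have [G Gsq JG] := hsqf.
have [m0 Gm0 le0] : exists2 m0, G m0 & (m0 <= m)%MM.
  have /initial_idealX := Im; rewrite JG.
  move=> /(_ [set g | forall m, m \in msupp g -> exists2 m0, G m0 & (m0 <= m)%MM]).
  apply; [split|..|by rewrite msuppX mem_head].
  - by move=> m'; rewrite msupp0.
  - by move=> f g Gf Gg m' /msuppD_le; rewrite mem_cat => /orP[/Gf|/Gg].
  - move=> a f Gf m' /msuppM_le/allpairsP[[x y] /= [_ /Gf[m0 Gm0 le0] ->]].
    by exists m0 => //; apply: lepm_trans le0 _; apply: lem_addl.
  - by move=> _ [m0 Gm0 <-] m'; rewrite msuppX inE => /eqP->; exists m0; rewrite ?lepm_refl.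
pose B := [set i | m0 i != 0%N]%SET.
have m0E : m0 = mono B.
  by apply/mnmP => i; rewrite mnmE inE; have := Gsq m0 Gm0 i; case: (m0 i) => [|[]].
have IB : (fun A => `[< InMon I (mono A) >]) B.
  by apply/asboolP/initial_idealX; rewrite JG -m0E; apply: sub_ideal_gen; exists m0.
have [A Amin AB] := @minset_exists _ (fun A => `[< InMon I (mono A) >]) B IB; exists A; first by rewrite inE.
by apply: lepm_trans le0; rewrite m0E mono_lem.
Qed.

(** The coefficients at the minimal generators vanish on the product of the initial
    ideal with the maximal ideal of the origin. They identify the quotient by
    this product with a vector space that any generating sequence spans. *)
Lemma mcoeff_min_supports (a g : {mpoly K[n]}) B : B \in min_supports -> J g ->
  (a * g)@_(mono B) = a@_0%MM * g@_(mono B).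
Proof.
move=> minB /initial_idealE-/(_ hle hI) Jg.
rewrite -{1}[a](subrK (a@_0%MM)%:MP) mulrDl mcoeffD mcoeffCM.
rewrite [X in X + _]memN_msupp_eq0 ?add0r //.
apply/negP => /msuppM_le/allpairsP[[x y] /= [xa /Jg Iy Exy]].
have [C minC le_y] := min_supports_lem Iy.
have CB : C = B.
  apply: min_supports_min minB (min_supportsP minC) _.
  by rewrite -mono_lem; apply: lepm_trans le_y _; rewrite Exy lem_addl.
have x0 : x = 0%MM.
  apply/mnmP => i; rewrite mnm0E; move/mnm_lepP: le_y => /(_ i).
  by rewrite CB Exy mnmDE; lia.
by move: xa; rewrite x0 mcoeff_msupp mcoeffB mcoeffC eqxx mulr1 subrr eqxx.
Qed.

Lemma card_min_supports (fs : seq {mpoly K[n]}) : J = ideal_gen [set` fs] ->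
  (#|min_supports| <= size fs)%N.
Proof.
move=> Jfs; pose u (j : 'I_#|min_supports|) := mono (enum_val j).
have umin (j : 'I_#|min_supports|) : enum_val j \in min_supports := enum_valP j.
have Jf (i : 'I_(size fs)) : J fs`_i.
  by rewrite Jfs; apply: sub_ideal_gen; apply: mem_nth.
have /choice[a aE] j : exists a : 'I_(size fs) -> {mpoly K[n]},
    'X_[u j] = \sum_i a i * fs`_i.
  by apply: ideal_gen_seqP; rewrite -Jfs; apply/initial_idealX/min_supportsP/umin.
pose P := \matrix_(j, i) (a j i)@_0%MM : 'M[K]_(#|min_supports|, size fs).
pose Q := \matrix_(i, j) (fs`_i)@_(u j) : 'M[K]_(size fs, #|min_supports|).
apply: (@mulmx1_min _ _ _ P Q); apply/matrixP => j k; rewrite !mxE.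
transitivity ('X_[u j]@_(u k) : K).
  rewrite aE raddf_sum; apply: eq_bigr => i _ /=; rewrite !mxE.
  by rewrite (mcoeff_min_supports _ (umin k) (Jf i)).
rewrite mcoeffX; congr (_ %:R); congr nat_of_bool; apply/eqP/eqP => [ujk|-> //].
apply: enum_val_inj; apply: min_supports_min (umin k) (min_supportsP (umin j)) _.
by rewrite -mono_lem -/(u j) ujk lepm_refl.
Qed.

(** If two minimal generators shared a variable, choosing it for both would give
    a set of variables that meets every generator and has fewer elements than the
    regular sequence, and a prime over this set would have too small a height. *)
Lemma complete_intersection_disjoint : is_complete_intersection J ->
  exists h (A : 'I_h -> {set 'I_n}), disjoint_initial le I A.
Proof.
move=> [fs fs_reg Jfs]; exists #|min_supports|, (fun j => enum_val j).
have JJ : is_ideal J by apply: ideal_genP.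
have nonempty A : A \in min_supports -> A != finset.set0.
  move=> minA; apply/eqP => A0; case: fs_reg => + _; apply; rewrite -Jfs.
  have -> : 1 = 'X_[mono A] :> {mpoly K[n]}.
    by rewrite -mpolyX0; congr 'X_[_]; apply/mnmP => i; rewrite A0 !mnmE inE.
  exact/initial_idealX/min_supportsP.
split=> [m|i j v vi vj|j]; last by apply: nonempty; apply: enum_valP.
  split=> [/min_supports_lem[A minA le_m]|[j le_m]].
    by exists (enum_rank_in minA A); rewrite enum_rankK_in.
  by apply: InMon_lem le_m => //; apply: min_supportsP; apply: enum_valP.
apply: enum_val_inj; apply: contrapT => /eqP neq.
set A := enum_val i in vi neq; set B := enum_val j in vj neq.
have minA : A \in min_supports := enum_valP i.
have minB : B \in min_supports := enum_valP j.
pose q (C : {set 'I_n}) := if (C == A) || (C == B) then v else odflt v [pick w in C].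
have qC C : C \in min_supports -> q C \in C.
  move=> minC; rewrite /q; case: eqP => [->|_] //=; case: eqP => [->|_] //=.
  case: pickP => //= C0; case/eqP: (nonempty C minC); apply/setP => w.
  by rewrite C0 inE.
pose V := [set q C | C in min_supports :\ B]%SET.
have VC C : C \in min_supports -> q C \in V.
  move=> minC; have [->|CB] := eqVneq C B.
    have -> : q B = q A by rewrite /q !eqxx orbT.
    by apply: imset_f; rewrite finset.in_setD1 neq.
  by apply: imset_f; rewrite finset.in_setD1 CB.
have JV m : InMon J m -> hit V m.
  move=> [f /initial_idealE-/(_ hle hI) Jf [/Jf]].
  move=> /min_supports_lem[C minC /mono_lemP le_m] _.
  by apply/hitP; exists (q C); [apply: VC|apply/le_m/qC].
have [P [PP JP PV]] := prime_hitting hle JJ JV.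
have := chain_length hle PV (regular_seq_chain fs_reg PP _).
have cardV : (#|V| < #|min_supports|)%N.
  by apply: leq_ltn_trans (leq_imset_card _ _) _; rewrite [X in (_ < X)%N](cardsD1 B) minB.
rewrite leqNgt (leq_trans cardV (card_min_supports Jfs)) => /(_ _)/negP[] //.
by move=> f ffs; apply: JP; rewrite Jfs; apply: sub_ideal_gen.
Qed.

End CompleteIntersection.

(** * The dual graph *)

Section DualGraph.
Variables (n : nat) (K : fieldType) (le : rel 'X_{1..n}).
Hypothesis hle : is_term_order le.
Variable I : set {mpoly K[n]}.
Hypothesis hI : is_ideal I.
Variables (h : nat) (A : 'I_h -> {set 'I_n}).
Hypothesis hA : disjoint_initial le I A.
Local Open Scope ring_scope.
Local Open Scope classical_set_scope.
Local Notation initial := (is_initial_monomial le).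
Local Notation InMon := (InMon le).
Implicit Types (m t : 'X_{1..n}) (P Q : set {mpoly K[n]}) (V : {set 'I_n}).
Implicit Types (q : 'I_h -> 'I_n).

(** The initial ideal of [P] is contained in the prime ideal generated by the
    variables in [V]. *)
Definition lies_over P V := forall m, InMon P m -> hit V m.

Definition transversal q := forall j, q j \in A j.

Definition cover q : {set 'I_n} := [set q j | j : 'I_h]%SET.

Lemma InMon_double m : InMon I (m + m)%MM -> InMon I m.
Proof.
have [IA _ _] := hA => /IA[j /mono_lemP mj]; apply/IA; exists j.
by apply/mono_lemP => i /mj; rewrite mnmDE addn_eq0 negb_and orbb.
Qed.

Lemma radical_I : is_radical I.
Proof. exact: radical_initial InMon_double. Qed.

Lemma lies_over_cover q : transversal q -> lies_over I (cover q).
Proof.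
have [IA _ _] := hA => qA m /IA[j /mono_lemP mj].
by apply/hitP; exists (q j); [apply: imset_f|apply/mj/qA].
Qed.

Lemma card_cover q : (#|cover q| <= h)%N.
Proof. by apply: leq_trans (leq_imset_card _ _) _; rewrite card_ord. Qed.

Lemma lies_overU P V V' : lies_over P V -> lies_over P (V :|: V')%SET.
Proof.
by move=> PV m /PV/hitP[i iV mi]; apply/hitP; exists i; rewrite ?inE ?iV.
Qed.

Lemma lies_overS P Q V : P `<=` Q -> lies_over Q V -> lies_over P V.
Proof. by move=> PQ QV m /(InMonS PQ)/QV. Qed.

Lemma prime_chain P : is_prime_ideal P -> I `<=` P -> has_chain P h.
Proof.
have [IA Adisj A0] := hA => PP IP.
have /choice[f fP] j : exists f, I f /\ initial f (mono (A j)).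
  by have [|f If fm] := (IA (mono (A j))).2; [exists j; rewrite lepm_refl|exists f].
have sizef : size [seq f j | j <- enum 'I_h] = h by rewrite size_map size_enum_ord.
rewrite -sizef; apply: regular_seq_chain PP _; last first.
  by move=> _ /mapP[j _ ->]; apply: IP; case: (fP j).
pose u i := nth 0%MM [seq mono (A j) | j <- enum 'I_h] i.
have uE (j : 'I_h) : u j = mono (A j).
  by rewrite /u (nth_map j) ?size_enum_ord // nth_ord_enum.
apply: (@coprime_regular _ _ _ hle _ u); rewrite sizef => i.
- move=> ih; rewrite (nth_map (Ordinal ih)) ?size_enum_ord //.
  by rewrite -[i]/(nat_of_ord (Ordinal ih)) nth_ord_enum uE; case: (fP (Ordinal ih)).
- move=> ih; rewrite -[i]/(nat_of_ord (Ordinal ih)) uE => uj0.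
  have /set0Pn[v vA] := A0 (Ordinal ih).
  by move/mnmP: uj0 => /(_ v); rewrite !mnmE vA.
- move=> j ih ji; have jh := ltn_trans ji ih.
  rewrite -[i]/(nat_of_ord (Ordinal ih)) -[j]/(nat_of_ord (Ordinal jh)) !uE => v.
  rewrite !mnmE; case: (boolP (v \in A (Ordinal jh))) => vj; last by left.
  case: (boolP (v \in A (Ordinal ih))) => vi; last by right.
  by have /(congr1 val) /= ij := Adisj _ _ _ vi vj; move: ji; rewrite ij ltnn.
Qed.

Lemma minimal_prime_colon P : is_minimal_prime I P -> exists2 d, ~ P d & colon I P d.
Proof.
move=> [PP IP Pmin]; apply: locally_zero => //; first exact: radical_I.
  exact: (ideal_fin_gen hle (prime_is_ideal PP)).
by move=> Q QP IQ QP'; rewrite (Pmin Q).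
Qed.

Lemma minimal_prime_nsub P Q : is_minimal_prime I P -> is_minimal_prime I Q ->
  P <> Q -> exists2 x, P x & ~ Q x.
Proof.
move=> [PP IP _] [_ _ Qmin] PQ; apply: contrapT => nox; apply: PQ; apply: Qmin => //.
by move=> x Px; apply: contrapT => nQx; apply: nox; exists x.
Qed.

(** The colon ideal of [I] by [P] is the intersection of the other minimal primes,
    so the initial ideals of the two add up to the initial ideal of their sum. *)
Lemma meeting_prime P Q V : is_minimal_prime I P -> is_minimal_prime I Q -> P <> Q ->
    lies_over P V -> lies_over Q V ->
  exists R, [/\ is_prime_ideal R, P `<=` R, colon I P `<=` R & lies_over R V].
Proof.
move=> Pm Qm PQ PV QV; have [PP IP _] := Pm; have [QP IQ _] := Qm.
have idP := prime_is_ideal PP; have idB := colonP P hI.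
have BQ : colon I P `<=` Q.
  have [x Px nQx] := minimal_prime_nsub Pm Qm PQ.
  by move=> y /(_ x Px)/IQ/(prime_mul QP)[].
have sumV : lies_over (ideal_sum P (colon I P)) V.
  move=> m /(initial_sum hle hI idP idB InMon_double IP (sub_colon hI)).
  case=> [a b Pa Bb|/PV //|/(lies_overS BQ QV) //].
  by rewrite mulrC; apply: Bb.
have [R [RP sR RV]] := prime_hitting hle (ideal_sumP idP idB) sumV.
exists R; split=> //.
- by move=> x Px; apply: sR; apply: ideal_suml.
- by move=> x Bx; apply: sR; apply: ideal_sumr.
Qed.

(** A prime over a transversal that contains both [P] and [colon I P] would strictly
    contain [P], so its height would exceed [h]. *)
Lemma minimal_prime_unique P Q q : is_minimal_prime I P -> is_minimal_prime I Q ->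
  lies_over P (cover q) -> lies_over Q (cover q) -> P = Q.
Proof.
move=> Pm Qm PV QV; apply: contrapT => PQ.
have [R [RP PR BR RV]] := meeting_prime Pm Qm PQ PV QV.
have [PP IP _] := Pm; have [d nPd Bd] := minimal_prime_colon Pm.
have ltPR : P `<` R by split=> // /(_ d (BR d Bd)).
have := chain_length hle RV (has_chainS (prime_chain PP IP) RP ltPR).
by rewrite leqNgt ltnS card_cover.
Qed.

Lemma clear_support V m j : (forall v, v \in A j -> v \in V -> m v != 0%N) ->
  exists2 t, ~~ hit V t & InMon I (t + m)%MM.
Proof.
have [IA _ _] := hA => mj; exists (mono (A j :\: V)).
  apply: hit_mono; rewrite -finset.setI_eq0; apply/eqP/setP => v.
  by rewrite !inE; case: (v \in V); rewrite ?andbF.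
apply/IA; exists j; apply/mono_lemP => v vA; rewrite mnmDE mnmE inE vA andbT.
by have [vV|//] := boolP (v \in V); rewrite add0n mj.
Qed.

Section AdjacentCovers.
Variables (q q' : 'I_h -> 'I_n) (k : 'I_h).
Hypotheses (qA : transversal q) (q'A : transversal q').
Hypothesis qq' : forall j, j != k -> q' j = q j.
Let V := (cover q :|: cover q')%SET.

Lemma adjacent_clear m : hit (cover q) m -> hit (cover q') m ->
  exists2 t, ~~ hit V t & InMon I (t + m)%MM.
Proof.
have [_ Adisj _] := hA => hq hq'.
have inV j v : v \in A j -> v \in V -> v = q j \/ v = q' j.
  by move=> vA; rewrite inE => /orP[] /imsetP[i _ vi]; [left|right];
    rewrite vi (Adisj j i v vA) // vi.
have [[j jk mj]|nj] := pselect (exists2 j, j != k & m (q j) != 0%N).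
  apply: (@clear_support _ _ j) => v vA /(inV j v vA)[->|->] //.
  by rewrite qq'.
apply: (@clear_support _ _ k) => v vA /(inV k v vA)[->|->].
- have /hitP[_ /imsetP[j _ ->] mj] := hq; have [<- //|jk] := eqVneq j k.
  by case: nj; exists j.
- have /hitP[_ /imsetP[j _ ->] mj] := hq'; have [<- //|jk] := eqVneq j k.
  by case: nj; exists j; rewrite // -qq'.
Qed.

(** Otherwise the initial monomials of [colon I P] would be initial in [I] up to
    monomials missing [V]. By Nakayama's lemma a polynomial whose initial monomial
    misses [V], and which is therefore outside [P], would multiply [colon I P]
    into [I], hence into [P]; but [colon I P] has an element outside [P]. *)
Lemma lies_over_adjacent P : is_minimal_prime I P -> lies_over P V ->
  lies_over P (cover q) \/ lies_over P (cover q').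
Proof.
move=> Pm PV; apply: contrapT => /not_orP[/existsNP[m1 /not_implyP[P1 n1]]].
move=> /existsNP[m2 /not_implyP[P2 n2]].
have [PP IP _] := Pm; have [c nPc Wc] := minimal_prime_colon Pm.
have prodI m m' : InMon (colon I P) m -> InMon P m' -> InMon I (m + m')%MM.
  move=> [f Wf fm] [g Pg gm']; exists (f * g); first exact: Wf.
  exact: initialM.
have hits r m m' : transversal r -> InMon (colon I P) m -> InMon P m' ->
    ~ hit (cover r) m' -> hit (cover r) m.
  move=> rA Wm Pm' nm'; have := lies_over_cover rA (prodI _ _ Wm Pm').
  by rewrite hitD => /orP[|/nm'].
have [||d [md dmd nmd] Wd] := initial_nakayama hle hI (colonP P hI) (V := V).
- exact: sub_colon.
- by move=> m Wm; apply: adjacent_clear; [apply: hits P1 n1|apply: hits P2 n2].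
have /IP/(prime_mul PP)[Pd|//] : I (d * c) by apply: Wd.
by case/negP: nmd; apply: PV; exists d.
Qed.

(** The prime [R] provided by [meeting_prime] has height at most [h + 1], as the two
    transversals have at most [h + 1] variables in all; what has to be shown is
    that it contains [Q]. *)
Lemma adjacent_edge P Q : is_minimal_prime I P -> is_minimal_prime I Q ->
    lies_over P (cover q) -> lies_over Q (cover q') ->
  P = Q \/ dual_edge I P Q.
Proof.
move=> Pm Qm Pq Qq'; have [|PQ] := pselect (P = Q); [by left|right].
have PV : lies_over P V by apply: lies_overU.
have QV : lies_over Q V by rewrite /V finset.setUC; apply: lies_overU.
have [R [RP PR BR RV]] := meeting_prime Pm Qm PQ PV QV.
have [PP IP Pmin] := Pm; have [QP IQ Qmin] := Qm.
(* If P were the only minimal prime inside R, then colon I P would not be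
   contained in R. Any other one lies over one of the two transversals, and by
   uniqueness it is Q. *)
have QR : Q `<=` R.
  have [S [SP IS SR nPS]] : exists S, [/\ is_prime_ideal S, I `<=` S, S `<=` R & ~ P `<=` S].
    apply: contrapT => noS.
    have [|||d nRd Bd] := @locally_zero _ I R P hI radical_I RP.
    - exact: (ideal_fin_gen hle (prime_is_ideal PP)).
    - move=> S SP IS SR; apply: contrapT => nPS; apply: noS; by exists S.
    - by move=> x /IP/PR.
    - exact: nRd (BR d Bd).
  have [T Tm TS] := minimal_prime_below SP IS.
  have TV : lies_over T V by apply: lies_overS RV => x /TS/SR.
  have [Tq|Tq'] := lies_over_adjacent Tm TV.
    by case: nPS; rewrite (minimal_prime_unique Pm Tm Pq Tq).
  by rewrite (minimal_prime_unique Qm Tm Qq' Tq') => x /TS/SR.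
have height_I : enat_le (Some h) (height I).
  by apply: le_height => S SP IS; apply: has_chain_le; apply: prime_chain.
apply/asboolP; split=> //; apply: enat_le_anti.
- apply: (@enat_le_trans (enat_succ (Some h))); last exact: enat_le_succ.
  apply: (@enat_le_trans (prime_height R)).
    by apply: height_le => //; apply: ideal_sum_min => //; apply: prime_is_ideal.
  apply: prime_height_le => l /(chain_length hle RV) /= /leq_trans; apply.
  have VU : V \subset (q' k |: cover q)%SET.
    apply/fintype.subsetP => v; rewrite !inE => /orP[->|]; first by rewrite orbT.
    move=> /imsetP[j _ ->]; have [->|/qq'->] := eqVneq j k; first by rewrite eqxx.
    by rewrite imset_f ?orbT.
  apply: leq_trans (subset_leq_card VU) _; rewrite cardsU1.
  by apply: leq_add (leq_b1 _) (card_cover q).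
- apply: le_height => S SP sS.
  have PS : P `<=` S by move=> x Px; apply: sS; apply: ideal_suml => //; apply: prime_is_ideal.
  have QS : Q `<=` S by move=> x Qx; apply: sS; apply: ideal_sumr => //; apply: prime_is_ideal.
  apply: enat_le_trans (enat_le_succ (height_le PP IP)) (prime_height_lt PP SP _).
  split=> // SP'; apply: PQ; apply/esym; apply: Pmin => // x /QS; exact: SP'.
Qed.

End AdjacentCovers.

Lemma minimal_prime_over q : transversal q ->
  exists P, is_minimal_prime I P /\ lies_over P (cover q).
Proof.
move=> qA; have [R [RP IR RV]] := prime_hitting hle hI (lies_over_cover qA).
have [P Pm PR] := minimal_prime_below RP IR.
by exists P; split=> //; apply: lies_overS PR RV.
Qed.

(** Reduced modulo [I], an element [c] outside [P] with [c * P] in [I] has an initial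
    monomial outside the initial ideal of [I], hence free of some transversal;
    multiplying by it shows that [P] lies over this transversal. *)
Lemma transversal_below P : is_minimal_prime I P ->
  exists2 q, transversal q & lies_over P (cover q).
Proof.
move=> Pm; have [PP IP _] := Pm; have [IA _ _] := hA.
have [c0 nPc0 Bc0] := minimal_prime_colon Pm.
have [g Ig c0g] := below_normal_form hle c0 hI.
set c := c0 - g in c0g.
have nPc : ~ P c.
  move=> Pc; apply: nPc0; rewrite -[c0](subrK g).
  exact: (is_idealD (prime_is_ideal PP) Pc (IP g Ig)).
have Bc : colon I P c.
  exact: (is_idealB (colonP P hI) Bc0 (sub_colon hI Ig)).
case: c0g => [c_0|[m cm nIm]].
  by case: nPc; rewrite c_0; exact: is_ideal0 (prime_is_ideal PP).
have /choice[q qP] j : exists v, v \in A j /\ m v = 0%N.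
  apply: contrapT => nov; apply: nIm; apply/IA; exists j; apply/mono_lemP => v vA.
  by apply/eqP => mv; apply: nov; exists v.
have qA : transversal q by move=> j; case: (qP j).
exists q => // m' [f Pf fm'].
have /(lies_over_cover qA) : InMon I (m + m')%MM.
  by exists (c * f); [apply: Bc|apply: initialM].
rewrite hitD => /orP[/hitP[_ /imsetP[j _ ->]]|//].
by case: (qP j) => _ ->.
Qed.

(** Exchanging the entries of two transversals one at a time gives a walk
    of length at most [h] between the corresponding minimal primes. *)
Lemma dual_dist_le P Q : is_minimal_prime I P -> is_minimal_prime I Q ->
  enat_le (dual_dist I P Q) (Some h).
Proof.
move=> Pm Qm; have [q qA Pq] := transversal_below Pm.
have [q' q'A Qq'] := transversal_below Qm.
pose hyb i j := if (nat_of_ord j < i)%N then q' j else q j.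
have hybA i : transversal (hyb i) by move=> j; rewrite /hyb; case: ifP.
have walk i : (i <= h)%N -> exists w, [/\ (size w <= i)%N, path (dual_edge I) P w,
    is_minimal_prime I (last P w) & lies_over (last P w) (cover (hyb i))].
  elim: i => [_|i IHi ih]; first by exists [::].
  have [w [sw pw wm wV]] := IHi (ltnW ih).
  have [S [Sm SV]] := minimal_prime_over (hybA i.+1).
  have [|SE|edge] := @adjacent_edge (hyb i) (hyb i.+1) (Ordinal ih) (hybA i) (hybA i.+1) _ _ _ wm Sm wV SV.
  - move=> j jk; rewrite /hyb ltnS leq_eqVlt; case: eqP => // ji.
    by case/eqP: jk; apply: val_inj.
  - by exists w; split=> //; [apply: ltnW|rewrite SE].
  - exists (rcons w S); rewrite size_rcons last_rcons rcons_path pw edge; split=> //.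
have [w [sw pw wm wV]] := walk h (leqnn h).
have wQ : last P w = Q.
  apply: minimal_prime_unique wm Qm wV _; suff -> : hyb h = q' by [].
  by apply/funext => j; rewrite /hyb ltn_ord.
apply: (@enat_le_trans (Some (size w))) => //.
by apply: enat_inf_le; exists w.
Qed.

Lemma disjoint_initial_Hirsch : Hirsch I.
Proof.
apply: (@enat_le_trans (Some h)).
  by apply: enat_sup_le => _ [P Pm [Q Qm <-]]; apply: dual_dist_le.
by apply: le_height => P PP IP; apply: has_chain_le; apply: prime_chain.
Qed.

End DualGraph.

Theorem corollary3p6 (K : fieldType) (hK : is_Q_or_Fp K) (n : nat)
    (I : set {mpoly K[n]}) (hI : is_ideal I)
    (le : rel 'X_{1..n}) (hle : is_term_order le)
    (hsqf : is_squarefree_monomial_ideal (initial_ideal le I))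
    (hci : is_complete_intersection (initial_ideal le I)) :
  Hirsch I.
Proof.
have [h [A hA]] := complete_intersection_disjoint hle hI hsqf hci.
exact: (disjoint_initial_Hirsch hle hI hA).
Qed.
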